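(* There exists an absolute constant $c>0$ such that for every prime $p$ and every algebraically closed field $k$ (of any characteristic), with $G=\mathrm{PSL}(2,p)$, the slice rank of the multiplication tensor $T_{k[G]}$ of the group algebra $k[G]$ is at least $c\,p^3$. Equivalently, $\mathrm{SR}(\mathrm{PSL}(2,p))\ge c\,p^3$, where $\mathrm{SR}(G)=\min_k \mathrm{SR}(T_{k[G]})$, the minimum over all algebraically closed fields $k$.
   Context: For a finite group $G$ and a field $k$, the multiplication tensor of the group algebra $k[G]$ is the trilinear form $T_{k[G]}:(k^{G})^{3}\to k$, $T_{k[G]}=\sum_{g,h\in G} x_g\,y_h\,z_{gh}$. For finite-dimensional $k$-vector spaces $U_1,U_2,U_3$ and a trilinear form $T:U_1\times U_2\times U_3\to k$, the slice rank $\mathrm{SR}(T)$ is the smallest $r$ such that $T$ can be written as a sum of $r$ trilinear forms each of the shape $f(u_1)g(u_2,u_3)$, $f(u_2)g(u_1,u_3)$ or $f(u_3)g(u_1,u_2)$ with $f$ linear and $g$ bilinear; equivalently, $\mathrm{SR}(T)$ is the minimum of $\operatorname{codim}V_1+\operatorname{codim}V_2+\operatorname{codim}V_3$ over subspaces $V_i\le U_i$ with $T(V_1,V_2,V_3)=0$. *)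

(* Defs.v *)
From HB Require Import structures.
From mathcomp Require Import all_boot all_order all_algebra all_fingroup all_solvable.
From Stdlib Require Import ClassicalDescription.
Set Implicit Arguments. Unset Strict Implicit. Unset Printing Implicit Defensive.
Import GRing.Theory.
Local Open Scope ring_scope.

(* A trilinear form T : k^I1 x k^I2 x k^I3 -> k is identified with its
   coefficient array T a b c (T(x,y,z) = sum_{a,b,c} T a b c x_a y_b z_c).
   A form f(u1) g(u2,u3) has coefficient array f a * g b c, etc.
   [slice_decomp T r] : T is a sum of r such slice forms. *)
Definition slice_decomp (k : fieldType) (I1 I2 I3 : finType)
    (T : I1 -> I2 -> I3 -> k) (r : nat) : Prop :=
  exists r1 r2 r3 : nat, (r1 + r2 + r3)%N = r /\
  exists (f1 : 'I_r1 -> I1 -> k) (g1 : 'I_r1 -> I2 -> I3 -> k)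
         (f2 : 'I_r2 -> I2 -> k) (g2 : 'I_r2 -> I1 -> I3 -> k)
         (f3 : 'I_r3 -> I3 -> k) (g3 : 'I_r3 -> I1 -> I2 -> k),
  forall a b c,
    T a b c = \sum_(i < r1) f1 i a * g1 i b c
            + \sum_(i < r2) f2 i b * g2 i a c
            + \sum_(i < r3) f3 i c * g3 i a b.

Lemma slice_decomp_exists (k : fieldType) (I1 I2 I3 : finType)
    (T : I1 -> I2 -> I3 -> k) : exists r, slice_decomp T r.
Proof.
exists #|I1|, #|I1|, 0%N, 0%N; split; first by rewrite !addn0.
exists (fun i a => (a == enum_val i)%:R), (fun i b c => T (enum_val i) b c).
exists (fun i _ => 0), (fun i _ _ => 0), (fun i _ => 0), (fun i _ _ => 0).
move=> a b c; rewrite !big_ord0 !addr0.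
rewrite (bigD1 (enum_rank a)) //= enum_rankK eqxx mul1r big1 ?addr0 //.
move=> i /negbTE Hi; case: eqP => [Ea|]; last by rewrite mul0r.
by move: Hi; rewrite Ea enum_valK eqxx.
Qed.

Definition slice_decompb (k : fieldType) (I1 I2 I3 : finType)
    (T : I1 -> I2 -> I3 -> k) (r : nat) : bool :=
  if excluded_middle_informative (slice_decomp T r) then true else false.

Lemma slice_decompb_exists (k : fieldType) (I1 I2 I3 : finType)
    (T : I1 -> I2 -> I3 -> k) : exists r, slice_decompb T r.
Proof.
have [r Hr] := slice_decomp_exists T; exists r.
by rewrite /slice_decompb; case: excluded_middle_informative.
Qed.

Definition slice_rank (k : fieldType) (I1 I2 I3 : finType)
    (T : I1 -> I2 -> I3 -> k) : nat :=
  ex_minn (slice_decompb_exists T).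

(* T_{k[G]} = sum_{g,h} x_g y_h z_{gh}: coefficient of x_a y_b z_c is [a*b = c]. *)
Definition group_alg_tensor (k : fieldType) (G : finGroupType) : G -> G -> G -> k :=
  fun a b c => ((a * b)%g == c)%:R.

Definition SL2_set (p : nat) : {set {'GL_2['F_p]}} :=
  [set g : {'GL_2['F_p]} | \det (GLval g) == 1].

Lemma SL2_group_set (p : nat) : group_set (SL2_set p).
Proof.
apply/group_setP; split; first by rewrite inE GL_1E det1.
move=> x y; rewrite !inE GL_MxE det_mulmx => /eqP-> /eqP->.
by rewrite mulr1.
Qed.

Canonical SL2 (p : nat) : {group {'GL_2['F_p]}} := Group (SL2_group_set p).

Definition PSL2 (p : nat) : {group coset_of 'Z(SL2 p)} := (SL2 p / 'Z(SL2 p))%G.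

Definition PSL2_type (p : nat) : finGroupType := subg_of (PSL2 p).
Arguments group_alg_tensor : clear implicits.

(* Main.v *)
(* The proof reduces to matrix multiplication over truncated polynomials. Let S be the tensor of
   n x n matrices over k[z] with entries of degree < h. If the slices in the first variable number
   less than c n^2 h, they vanish at some X = A z^d + ... with d < h/2 and rank A > n/2: a space of
   matrices of rank at most s has codimension at least (n-s)^2. Multiplication by such an X has rank
   at least c n^2 h, which bounds the number of remaining slices. So it is enough to realise S, with
   n and h of order p, as a restriction of the tensor of k[PSL(2,p)].

   In characteristic p, the symmetric powers Sym^r, r even and r < p-1, have jointly linearly
   independent matrix coefficients, so k[PSL(2,p)] surjects onto the product of their matrix algebras;
   the corresponding diagonal tensor contains that of polynomial multiplication by Lagrange
   interpolation.

   In the other characteristics, let e be the idempotent of a nontrivial additive character of the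
   unipotent group U and T the diagonal torus. The conjugates t e t^-1 are orthogonal, so the elements
   t e Y^a t'^-1, for Y in the Hecke algebra e k[G] e, multiply like matrix units times powers of z.
   The algebra e k[G] e acts on the e-part of the permutation module of the plane, which is the group
   ring of T, through Kloosterman-type sums; Fourier inversion of these yields a Y which acts as
   x + 1/x up to the norm element, x a generator of T, and has linearly independent powers up to order
   |T|/2. This needs no information on the modular representations of G. *)
From HB Require Import structures.
Require Import Defs.
From mathcomp Require Import all_boot all_order all_algebra all_fingroup all_solvable.
From mathcomp Require Import finfield ring zify.
Set Implicit Arguments. Unset Strict Implicit. Unset Printing Implicit Defensive.
Import GRing.Theory Num.Theory.
Local Open Scope ring_scope.

(** * Truncated polynomial matrix multiplication *)

(* dim_matrix is stated with the ring product of nat, opaque to the nat lemmas. *)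
Lemma dim_mx (K : fieldType) (m n : nat) : dim 'M[K]_(m, n) = (m * n)%N.
Proof. exact: dim_matrix. Qed.

Lemma linear_hom (K : fieldType) (U V : vectType K) (f : U -> V) :
  linear f -> exists F : 'Hom(U, V), F =1 f.
Proof.
move=> f_lin.
pose lf : {linear U -> V} := HB.pack f (GRing.isLinear.Build K U V *:%R f f_lin).
by exists (linfun lf) => x; rewrite lfunE.
Qed.

Lemma common_zero (K : fieldType) (U V : vectType K) (F : 'Hom(U, V)) :
  (dim V < dim U)%N -> exists2 u, u != 0 & F u = 0.
Proof.
move=> ltVU; have := limg_ker_dim F fullv; rewrite capfv dimvf => dimF.
have : lker F != 0%VS.
  rewrite -dimv_eq0; apply: contraL ltVU => /eqP kF0.
  by rewrite -leqNgt -dimF kF0 add0n -dimvf dimvS ?subvf.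
rewrite -vpick0 => nz; exists (vpick (lker F)) => //.
by apply/eqP; rewrite -memv_ker memv_pick.
Qed.

(* The minor of pid_mx s + t B on rows 0..s-1, i and columns 0..s-1, j is t times a
   polynomial in t with value B i j at 0. *)
Lemma rank_pid_pencil (k : closedFieldType) (n s : nat) (B : 'M[k]_n) (i j : 'I_n) :
  (s <= i)%N -> (s <= j)%N -> B i j != 0 ->
  exists t, (s < \rank (pid_mx s + t *: B)%R)%N.
Proof.
move=> si sj Bij.
pose emb (l : 'I_n) (a : 'I_s.+1) : 'I_n := if (a < s)%N then insubd l (a : nat) else l.
have embE (l : 'I_n) (a : 'I_s.+1) : (s <= l)%N -> emb l a = (if (a < s)%N then a : nat else l) :> nat.
  move=> sl; rewrite /emb; case: ifP => // a_s.
  by rewrite val_insubd (ltn_trans a_s) // (leq_ltn_trans sl).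
(* The minor is [diag(1, ..., 1, t)] times [Q] at [t]: the factor [t] of the last row is taken out.
   At 0 the matrix [Q] is lower triangular with diagonal [1, ..., 1, B i j], so a [t] that is a root
   of neither ['X] nor [\det Q] works. *)
pose Q : 'M[{poly k}]_s.+1 := \matrix_(a, b)
  if (a < s)%N then (a == b)%:R + 'X * (B (emb i a) (emb j b))%:P else (B i (emb j b))%:P.
have Q0 : (\det Q).[0] = B i j.
  rewrite -horner_evalE -det_map_mx det_trig; last first.
    apply/is_trig_mxP=> a b ab; rewrite !mxE (leq_trans ab) ?leq_ord // /= horner_evalE !hornerE.
    by rewrite -val_eqE ltn_eqF // horner0.
  rewrite big_ord_recr /= !mxE ltnn /= horner_evalE hornerC big1 => [|a _].
    rewrite mul1r.
    have -> // : emb j ord_max = j by apply/val_inj; rewrite /= embE //= ltnn.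
  by rewrite !mxE /= ltn_ord horner_evalE !hornerE eqxx hornerE.
have [t] : exists t, ~~ root ('X * \det Q) t.
  apply/closed_nonrootP; rewrite mulf_neq0 ?polyX_eq0 //.
  by apply: contra_neq Bij => Q0'; rewrite -Q0 Q0' horner0.
rewrite /root hornerM hornerX mulf_eq0 negb_or => /andP[t0 Qt]; exists t.
pose N := mxsub (emb i) (emb j) (pid_mx s + t *: B).
pose d : 'rV[k]_s.+1 := \row_a if (a < s)%N then 1 else t.
have NE : N = diag_mx d *m map_mx (horner_eval t) Q.
  apply/matrixP=> a b; rewrite mul_diag_mx !mxE horner_evalE embE // embE //.
  have [a_s|s_a] := ltnP a s.
    rewrite a_s andbT mul1r !hornerE; congr (_ + _).
    have [b_s|s_b] := ltnP b s; first by rewrite -val_eqE; case: eqP; rewrite hornerE.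
    by rewrite -val_eqE !ltn_eqF ?hornerE ?(leq_trans a_s).
  by rewrite [(i < s)%N]ltnNge si andbF add0r hornerC /emb ltnNge s_a.
have : (s < \rank N)%N.
  suff : N \in unitmx by rewrite -row_free_unit => /eqP->.
  rewrite unitmxE unitfE NE det_mulmx det_diag mulf_neq0 //; last first.
    by rewrite (det_map_mx (horner_eval t)).
  by apply/prodf_neq0 => a _; rewrite mxE; case: ifP => _ //; rewrite oner_eq0.
move/leq_trans; apply; rewrite /N mxsubrc (leq_trans (mxrankS (rowsub_sub _ _))) //.
by rewrite -mxrank_tr trmx_mxsub -[leqRHS]mxrank_tr mxrankS ?rowsub_sub.
Qed.

(** If some [A] in [W] has rank exactly [s], choose bases in which it is [pid_mx s]. For each [B] in
    [W] the whole line [A + t B] has rank at most [s], so by [rank_pid_pencil] the lower right block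
    of [B], of size [n - s], vanishes. If the rank [s] is not attained, the bound for [s - 1] is
    stronger. *)
Lemma dim_bounded_rank (k : closedFieldType) (n s : nat) (W : {vspace 'M[k]_n}) :
  (s <= n)%N -> (forall A, A \in W -> (\rank A <= s)%N) ->
  (\dim W + (n - s) ^ 2 <= n ^ 2)%N.
Proof.
elim: s => [|s IHs] sn leW.
  have -> : W = 0%VS.
    apply/eqP; rewrite -subv0; apply/subvP=> A /leW.
    by rewrite leqn0 mxrank_eq0 => /eqP->; rewrite mem0v.
  by rewrite dimv0 subn0.
have [|noA] := Classical_Prop.classic (exists2 A, A \in W & \rank A = s.+1); last first.
  apply: leq_trans (IHs (ltnW sn) _); first by rewrite leq_add2l leq_exp2r // leq_sub2l.
  move=> A AW; have := leW A AW; rewrite leq_eqVlt => /orP[/eqP rA|//].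
  by case: noA; exists A.
move: (s.+1) sn leW => {IHs}s sn leW [A AW rA].
set L := col_ebase A; set R := row_ebase A.
have Lu : L \in unitmx by rewrite col_ebase_unit.
have Ru : R \in unitmx by rewrite row_ebase_unit.
have lt_emb (a : 'I_(n - s)) : (s + a < n)%N by rewrite -ltn_subRL.
pose emb a := Ordinal (lt_emb a).
have [F FE] : exists F : 'Hom('M[k]_n, 'M[k]_(n - s)),
    F =1 fun B => mxsub emb emb (invmx L *m B *m invmx R).
  apply: linear_hom => c B B'; rewrite mulmxDr mulmxDl -scalemxAr -scalemxAl.
  by apply/matrixP=> a b; rewrite !mxE.
have W_F : (W <= lker F)%VS.
  apply/subvP=> B BW; rewrite memv_ker FE; apply/eqP/matrixP=> a b; rewrite mxE [RHS]mxE.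
  apply/eqP; apply: contraT => nz.
  have [t] := @rank_pid_pencil k n s (invmx L *m B *m invmx R) (emb a) (emb b)
    (leq_addr _ _) (leq_addr _ _) nz.
  rewrite ltnNge => /negP[]; apply: leq_trans (leW (A + t *: B) _); last first.
    by rewrite memvD ?memvZ.
  rewrite -[in X in (_ <= \rank X)%N](mulmx_ebase A) rA -/L -/R.
  have -> : t *: B = L *m (t *: (invmx L *m B *m invmx R)) *m R.
    by rewrite -scalemxAr -scalemxAl !mulmxA mulmxV // mul1mx mulmxKV.
  rewrite -mulmxDl -mulmxDr mxrankMfree ?row_free_unit //.
  by rewrite eqmxMfull // row_full_unit.
have F_full : limg F = fullv.
  apply/eqP; rewrite eqEsubv subvf; apply/subvP=> C _; apply/memv_imgP.
  pose C' : 'M[k]_n := \matrix_(i, j)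
    if insub (i - s)%N is Some a then if insub (j - s)%N is Some b then C a b else 0 else 0.
  exists (L *m C' *m R); rewrite ?memvf // FE !mulmxA mulVmx // mul1mx mulmxK //.
  by apply/matrixP=> a b; rewrite !mxE /= !addKn !valK.
have := limg_ker_dim F fullv; rewrite F_full capfv !dimvf !dim_mx !mulnn => <-.
by rewrite leq_add ?dimvS.
Qed.

(** Filter [V] by order of vanishing. The leading coefficients in degree [e] form a space of
    dimension at most [n ^ 2], and [dim_bounded_rank] saves [(n - s) ^ 2] for each [e < d]. *)
Lemma dim_flag (k : closedFieldType) (n s h d : nat) (V : {vspace {ffun 'I_h -> 'M[k]_n}}) :
  (s <= n)%N -> (d <= h)%N ->
  (forall (X : {ffun 'I_h -> 'M[k]_n}) (i : 'I_h), X \in V -> (i < d)%N ->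
    (forall j : 'I_h, (j < i)%N -> X j = 0) -> (\rank (X i) <= s)%N) ->
  (\dim V + d * (n - s) ^ 2 <= h * n ^ 2)%N.
Proof.
move=> sn dh leV.
suff flag m e : (m + e = h)%N -> forall V' : {vspace {ffun 'I_h -> 'M[k]_n}}, (V' <= V)%VS ->
    (forall (X : {ffun 'I_h -> 'M[k]_n}) (j : 'I_h), X \in V' -> (j < e)%N -> X j = 0) ->
    (\dim V' + (d - e) * (n - s) ^ 2 <= m * n ^ 2)%N.
  by have := flag h 0%N (addn0 h) V (subvv _); rewrite subn0; apply.
elim: m e => [|m IHm] e; rewrite ?add0n => he V' V'V V'0.
  have -> : V' = 0%VS.
    apply/eqP; rewrite -subv0; apply/subvP=> X XV'; rewrite memv0; apply/eqP/ffunP=> j.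
    by rewrite ffunE (V'0 X j) // he.
  by rewrite dimv0 he (eqP dh).
have lt_e : (e < h)%N by lia.
pose i := Ordinal lt_e.
have [F FE] : exists F : 'Hom({ffun 'I_h -> 'M[k]_n}, 'M[k]_n), F =1 fun X => X i.
  by apply: linear_hom => c X Y; rewrite !ffunE.
have IH : (\dim (V' :&: lker F) + (d - e.+1) * (n - s) ^ 2 <= m * n ^ 2)%N.
  apply: IHm; [by lia | exact: subv_trans (capvSl _ _) V'V | move=> X j].
  rewrite memv_cap memv_ker FE => /andP[XV' /eqP Xi0]; rewrite ltnS leq_eqVlt.
  by case/orP=> [/eqP ji|/V'0->//]; rewrite -Xi0; congr (X _); apply/val_inj.
have imF : (\dim (F @: V') + (e < d) * (n - s) ^ 2 <= n ^ 2)%N.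
  case: ltnP => [ed|_]; rewrite ?mul1n ?mul0n ?addn0; last first.
    by rewrite (leq_trans (dimvS (subvf _))) // dimvf dim_mx mulnn.
  apply: dim_bounded_rank => // _ /memv_imgP[X XV' ->]; rewrite FE.
  apply: leV => //; first exact: (subvP V'V).
  by move=> j ji; rewrite (V'0 X).
rewrite -(limg_ker_dim F V') mulSn.
have -> : ((d - e) * (n - s) ^ 2 = (d - e.+1) * (n - s) ^ 2 + (e < d) * (n - s) ^ 2)%N.
  by rewrite -mulnDl; congr (_ * _)%N; case: ltnP; lia.
by rewrite addnACA addnC leq_add // addnC.
Qed.

Definition matpoly_tensor (k : fieldType) (n h : nat) (x y z : 'I_n * 'I_n * 'I_h) : k :=
  [&& x.1.1 == z.1.1, x.1.2 == y.1.1, y.1.2 == z.1.2 & (x.2 + y.2 == z.2)%N]%:R.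

Lemma rank_compression (K : fieldType) (m n : nat) (A : 'M[K]_(m, n)) :
  exists (B : 'M_(\rank A, m)) (Q : 'M_(n, \rank A)), B *m A *m Q = 1%:M.
Proof.
have [Q AQ] := row_freeP (row_base_free A).
have [B BA] := row_fullP (col_base_full A).
exists B, Q; transitivity (B *m (col_base A *m row_base A) *m Q); first by rewrite mulmx_base.
by rewrite mulmxA BA mul1mx AQ.
Qed.

Lemma sum_triple (R : nmodType) (I J K : finType) (F : I * J * K -> R) :
  \sum_x F x = \sum_a \sum_i \sum_j F (i, j, a).
Proof.
rewrite exchange_big /= -(eq_bigr _ (fun _ _ => exchange_big _ _ _ _ _ _)) /=.
rewrite pair_bigA /= (pair_bigA _ (fun p a => F (p.1, p.2, a))) /=.
by apply: eq_bigr => -[[i j] a].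
Qed.

Lemma matpoly_tensorE (k : fieldType) (n h : nat) (X Y : 'I_h -> 'M[k]_n) (z : 'I_n * 'I_n * 'I_h) :
  \sum_x \sum_y X x.2 x.1.1 x.1.2 * Y y.2 y.1.1 y.1.2 * matpoly_tensor k x y z =
  \sum_(a < h) \sum_(b < h | (a + b == z.2)%N) (X a *m Y b) z.1.1 z.1.2.
Proof.
case: z => [[i0 l0] c]; rewrite sum_triple; apply: eq_bigr => a _ /=.
rewrite (bigD1 i0) //= [X in _ + X]big1 ?addr0 => [|i /negPf ni]; last first.
  by apply: big1 => j _; apply: big1 => y _; rewrite /matpoly_tensor /= ni mulr0.
under eq_bigr do rewrite sum_triple.
rewrite exchange_big [RHS]big_mkcond /=; apply: eq_bigr => b _.
case: ifP => abc; last first.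
  by do 3![apply: big1 => ? _]; rewrite /matpoly_tensor /= abc !andbF mulr0.
rewrite mxE; apply: eq_bigr => j _.
rewrite (bigD1 j) //= [X in _ + X]big1 ?addr0 => [|j' nj]; last first.
  by apply: big1 => l _; rewrite /matpoly_tensor /= eq_sym (negPf nj) andbF mulr0.
rewrite (bigD1 l0) //= [X in _ + X]big1 ?addr0 => [|l /negPf nl]; last first.
  by rewrite /matpoly_tensor /= nl !andbF mulr0.
by rewrite /matpoly_tensor /= !eqxx abc mulr1.
Qed.

(* If the slices in the first variable are few, they vanish at some X = A z^d + higher order terms
   with d < m and rank A > n; multiplication by X is then injective on a space of dimension
   2nm * rank A, too large for the other slices to separate its points. *)
Lemma slice_rank_matpoly (k : closedFieldType) (n m r : nat) :
  slice_decomp (@matpoly_tensor k n.*2 m.*2) r -> (m * n ^ 2 <= r)%N.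
Proof.
move=> [r1] [r2] [r3] [<- [f1] [g1] [f2] [g2] [f3] [g3] dec].
have [F1 F1E] : exists F : 'Hom({ffun 'I_m.*2 -> 'M[k]_n.*2}, 'rV[k]_r1),
    F =1 fun X => \row_s \sum_x X x.2 x.1.1 x.1.2 * f1 s x.
  apply: linear_hom => c X Y; apply/rowP=> s; rewrite !mxE mulr_sumr -big_split /=.
  by apply: eq_bigr => x _; rewrite !ffunE !mxE mulrDl mulrA.
have [le1|lt1] := leqP (m * n ^ 2) r1; first by rewrite -addnA (leq_trans le1) ?leq_addr.
have [X [d [X0 dm Xlow rX]]] : exists (X : {ffun 'I_m.*2 -> 'M[k]_n.*2}) (d : 'I_m.*2),
    [/\ F1 X = 0, (d < m)%N, (forall j : 'I_m.*2, (j < d)%N -> X j = 0)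
      & (n < \rank (X d))%N].
  (* Otherwise [dim_flag] gives the kernel of [F1] codimension at least [m * n ^ 2], but the
     codimension is at most [r1]. *)
  apply: Classical_Prop.NNPP => noX.
  have := @dim_flag k n.*2 n m.*2 m (lker F1).
  have -> : (n <= n.*2)%N by lia.
  have -> : (m <= m.*2)%N by lia.
  have := limg_ker_dim F1 fullv; rewrite capfv dimvf => dimE.
  have := dimvS (subvf (limg F1)); rewrite !dimvf dim_mx => dimF dimV.
  have {dimV} : (\dim (lker F1) + m * (n.*2 - n) ^ 2 <= m.*2 * n.*2 ^ 2)%N.
    apply: dimV => // X i XF im Xlow; rewrite leqNgt; apply/negP=> rX.
    by case: noX; exists X, i; split=> //; apply/eqP; rewrite -memv_ker.
  have dE : dim {ffun 'I_m.*2 -> 'M[k]_n.*2} = (m.*2 * n.*2 ^ 2)%N.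
    by rewrite -[LHS]/(#|'I_m.*2| * dim 'M[k]_n.*2)%N card_ord dim_mx mulnn.
  have -> : (n.*2 - n = n)%N by rewrite -addnn addnK.
  by move: dimE; rewrite dE => <-; rewrite leq_add2l leqNgt (leq_ltn_trans dimF) // mul1n.
have [B [Q BAQ]] := rank_compression (X d).
set s := \rank (X d) in B Q BAQ rX.
(* The second factor has degree below [m], so that its leading term times that of [X] survives the
   truncation at [m.*2]. Its columns lie in the image of [Q], on which [X d] is injective. *)
pose Y (u : {ffun 'I_m -> 'M[k]_(s, n.*2)}) (b : 'I_m.*2) : 'M[k]_n.*2 :=
  if insub (b : nat) is Some b' then Q *m u b' else 0.
pose XY (a : 'I_m.*2 -> 'M[k]_n.*2) : 'I_n.*2 * 'I_n.*2 * 'I_m.*2 -> k :=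
  fun x => a x.2 x.1.1 x.1.2.
pose idx : finType := ('I_n.*2 * 'I_n.*2 * 'I_m.*2)%type.
(* With [X] fixed, a slice in the third variable contributes a multiple of [f3 t] whose factor is
   linear in [u]; killing this factor costs one linear condition, as for the slices in the second
   variable. *)
have [F2 F2E] : exists F : 'Hom({ffun 'I_m -> 'M[k]_(s, n.*2)}, 'rV[k]_(r2 + r3)),
    F =1 fun u => row_mx (\row_(t < r2) \sum_(y : idx) XY (Y u) y * f2 t y)
                         (\row_(t < r3) \sum_(y : idx) XY (Y u) y * \sum_(x : idx) XY X x * g3 t x y).
  apply: linear_hom => c u v.
  have YD : XY (Y (c *: u + v)) =1 fun y => c * XY (Y u) y + XY (Y v) y.
    move=> y; rewrite /XY /Y; case: insub => [b|]; last by rewrite !mxE mulr0 addr0.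
    by rewrite !ffunE mulmxDr -scalemxAr !mxE.
  rewrite scale_row_mx add_row_mx; congr row_mx; apply/rowP=> t;
    rewrite !mxE mulr_sumr -big_split; apply: eq_bigr => y _;
    by rewrite YD mulrDl mulrA.
have [le23|lt23] := leqP (m * n ^ 2) (r2 + r3).
  by rewrite -addnA (leq_trans le23) ?leq_addl.
have [|u u0 F2u] := @common_zero _ _ _ F2.
  rewrite -[X in (_ < X)%N]/(#|'I_m| * dim 'M[k]_(s, n.*2))%N card_ord !dim_mx mul1n.
  by rewrite (leq_trans lt23) // leq_mul2l -mulnn leq_mul ?orbT //; lia.
have Tuv0 z : \sum_x \sum_y XY X x * XY (Y u) y * matpoly_tensor k x y z = 0.
  have : \row_t \sum_(x : idx) XY X x * f1 t x = 0 by rewrite -[RHS]X0 F1E.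
  move/rowP=> X1; move: F2u; rewrite F2E -row_mx0 => /eq_row_mx[/rowP Y2 /rowP Y3].
  under eq_bigr => x _ do under eq_bigr => y _ do rewrite dec !mulrDr.
  under eq_bigr => x _ do rewrite !big_split /=.
  rewrite !big_split /= exchange_big /= [X in X + _ + _]big1; last first.
    move=> y _.
    transitivity (\sum_(t < r1) (\sum_(x : idx) XY X x * f1 t x) * (XY (Y u) y * g1 t y z)).
      under [RHS]eq_bigr do rewrite mulr_suml.
      rewrite exchange_big; apply: eq_bigr => x _ /=; rewrite mulr_sumr.
      by apply: eq_bigr => t _; rewrite [RHS]mulrACA.
    by apply: big1 => t _; have := X1 t; rewrite !mxE => ->; rewrite mul0r.
  rewrite [X in _ + X + _]big1 ?add0r; last first.
    move=> x _.
    transitivity (\sum_(t < r2) (\sum_(y : idx) XY (Y u) y * f2 t y) * (XY X x * g2 t x z)).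
      under [RHS]eq_bigr do rewrite mulr_suml.
      rewrite [RHS]exchange_big; apply: eq_bigr => y _ /=; rewrite mulr_sumr.
      by apply: eq_bigr => t _; rewrite [RHS]mulrACA [XY X x * _]mulrC.
    by apply: big1 => t _; have := Y2 t; rewrite !mxE => ->; rewrite mul0r.
  transitivity (\sum_(t < r3)
      (\sum_(y : idx) XY (Y u) y * \sum_(x : idx) XY X x * g3 t x y) * f3 t z).
    under [RHS]eq_bigr do rewrite mulr_suml.
    rewrite exchange_big [RHS]exchange_big; apply: eq_bigr => y _ /=.
    under [RHS]eq_bigr do rewrite mulr_sumr mulr_suml.
    rewrite [RHS]exchange_big; apply: eq_bigr => x _ /=; rewrite mulr_sumr.
    by apply: eq_bigr => t _; ring.
  by apply: big1 => t _; have := Y3 t; rewrite !mxE => ->; rewrite mul0r.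
have [b0 ub0 minb] : exists2 b0, u b0 != 0 & forall b : 'I_m, (b < b0)%N -> u b = 0.
  have /existsP[b1 ub1] : [exists b, u b != 0].
    by apply: contraNT u0 => /existsPn u0; apply/eqP/ffunP=> b; rewrite ffunE; apply/eqP/negbNE.
  have [b0 ub0 minb] := @arg_minnP _ b1 (fun b => u b != 0) (@nat_of_ord m) ub1.
  exists b0 => // b.
  by rewrite ltnNge => bb; apply/eqP; apply: contraNT bb => /minb.
have lt_c : (d + b0 < m.*2)%N by have := ltn_ord b0; lia.
have lt_b0 : (b0 < m.*2)%N by have := ltn_ord b0; lia.
(* This is the coefficient of degree [d + b0] of a vanishing product: every other pair of degrees
   with the same sum has one factor below its leading term. *)
case/negP: ub0; have: X d *m (Q *m u b0) = 0.
  apply/matrixP=> i l; rewrite [RHS]mxE -[RHS](Tuv0 (i, l, Ordinal lt_c)).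
  rewrite matpoly_tensorE /= (bigD1 d) //= (bigD1 (Ordinal lt_b0)) //=.
  rewrite [X in _ + X + _]big1 ?addr0 => [|b /andP[/eqP/addnI db /eqP[]]]; last first.
    exact: val_inj.
  rewrite [X in _ + X]big1 ?addr0 => [|a ad]; last first.
    apply: big1 => b /eqP abc; have [ltad|lead] := ltnP a d.
      by rewrite Xlow // mul0mx mxE.
    have bb0 : (b < b0)%N by move: ad; rewrite -val_eqE /=; lia.
    rewrite /Y insubT; first by rewrite (ltn_trans bb0).
    by move=> bm; rewrite minb // !mulmx0 mxE.
  by rewrite /Y /= valK.
by move/(congr1 (mulmx B)); rewrite mulmx0 !mulmxA BAQ mul1mx => ->.
Qed.

(** * Restrictions of group algebra tensors *)

Lemma slice_decomp_restrict (k : fieldType) (I1 I2 I3 J1 J2 J3 : finType)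
    (T : I1 -> I2 -> I3 -> k) (x : J1 -> I1 -> k) (y : J2 -> I2 -> k) (z : J3 -> I3 -> k) r :
  slice_decomp T r ->
  slice_decomp (fun a b c => \sum_i \sum_j \sum_l x a i * y b j * z c l * T i j l) r.
Proof.
move=> [r1 [r2 [r3 [<- [f1 [g1 [f2 [g2 [f3 [g3 dec]]]]]]]]]].
exists r1, r2, r3; split => //.
exists (fun t a => \sum_i x a i * f1 t i), (fun t b c => \sum_j \sum_l y b j * z c l * g1 t j l).
exists (fun t b => \sum_j y b j * f2 t j), (fun t a c => \sum_i \sum_l x a i * z c l * g2 t i l).
exists (fun t c => \sum_l z c l * f3 t l), (fun t a b => \sum_i \sum_j x a i * y b j * g3 t i j).
move=> a b c.
under eq_bigr => i _ do under eq_bigr => j _ do under eq_bigr => l _ do rewrite dec !mulrDr.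
under eq_bigr => i _ do under eq_bigr => j _ do rewrite !big_split /=.
under eq_bigr => i _ do rewrite !big_split /=.
rewrite !big_split /=; congr (_ + _ + _).
- under [RHS]eq_bigr => t _ do rewrite mulr_suml.
  rewrite [RHS]exchange_big; apply: eq_bigr => i _ /=.
  under [RHS]eq_bigr => t _ do rewrite mulr_sumr.
  rewrite [RHS]exchange_big; apply: eq_bigr => j _ /=.
  under [RHS]eq_bigr => t _ do rewrite mulr_sumr.
  rewrite [RHS]exchange_big; apply: eq_bigr => l _ /=.
  by rewrite mulr_sumr; apply: eq_bigr => t _; ring.
- rewrite exchange_big /=; under [RHS]eq_bigr => t _ do rewrite mulr_suml.
  rewrite [RHS]exchange_big; apply: eq_bigr => j _ /=.
  under [RHS]eq_bigr => t _ do rewrite mulr_sumr.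
  rewrite [RHS]exchange_big; apply: eq_bigr => i _ /=.
  under [RHS]eq_bigr => t _ do rewrite mulr_sumr.
  rewrite [RHS]exchange_big; apply: eq_bigr => l _ /=.
  by rewrite mulr_sumr; apply: eq_bigr => t _; ring.
- under eq_bigr => i _ do rewrite exchange_big /=.
  rewrite exchange_big /=; under [RHS]eq_bigr => t _ do rewrite mulr_suml.
  rewrite [RHS]exchange_big; apply: eq_bigr => l _ /=.
  under [RHS]eq_bigr => t _ do rewrite mulr_sumr.
  rewrite [RHS]exchange_big; apply: eq_bigr => i _ /=.
  under [RHS]eq_bigr => t _ do rewrite mulr_sumr.
  rewrite [RHS]exchange_big; apply: eq_bigr => j _ /=.
  by rewrite mulr_sumr; apply: eq_bigr => t _; ring.
Qed.

Lemma slice_decomp_ext (k : fieldType) (I1 I2 I3 : finType) (T T' : I1 -> I2 -> I3 -> k) r :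
  (forall a b c, T a b c = T' a b c) -> slice_decomp T r -> slice_decomp T' r.
Proof.
move=> TT' [r1 [r2 [r3 [e [f1 [g1 [f2 [g2 [f3 [g3 dec]]]]]]]]]].
exists r1, r2, r3; split => //; exists f1, g1, f2, g2, f3, g3 => a b c.
by rewrite -TT' dec.
Qed.

Section QuotientGroupAlgebra.

Variables (k : fieldType) (gT : finGroupType) (H : {group gT}).
Let Q := (H / 'Z(H)%g)%G.

(** This allows restrictions of the tensor of the quotient to be written as sums over [H]: [x] and
    [y] are pushed forward along the fibres of the projection, and [f], constant on the cosets of
    the centre, descends. *)
Lemma slice_decomp_quotient (J1 J2 J3 : finType)
    (x : J1 -> gT -> k) (y : J2 -> gT -> k) (f : J3 -> gT -> k) r :
  (forall c z g, z \in 'Z(H)%g -> g \in H -> f c (z * g)%g = f c g) ->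
  slice_decomp (group_alg_tensor k (subg_of Q)) r ->
  slice_decomp (fun a b c => \sum_(g in H) \sum_(h in H) x a g * y b h * f c (g * h)%g) r.
Proof.
move=> fZ.
pose pr (g : gT) : subg_of Q := subg Q (coset 'Z(H)%g g).
have nZ : H \subset 'N('Z(H))%g by rewrite normal_norm ?center_normal.
have prM : {in H &, {morph pr : g h / (g * h)%g}}.
  move=> g h gH hH; rewrite /pr morphM ?(subsetP nZ) //.
  by rewrite -[RHS]sgvalK /= !subgK ?mem_quotient.
pose lft (q : subg_of Q) := repr (sgval q).
have lftK g c : g \in H -> f c (lft (pr g)) = f c g.
  move=> gH; rewrite /lft /pr subgK ?mem_quotient //.
  have := mem_repr_coset (coset 'Z(H)%g g); rewrite val_coset ?(subsetP nZ) //.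
  by case/rcosetP=> z zZ ->; apply: fZ.
pose push (u : gT -> k) (q : subg_of Q) := \sum_(g in H | pr g == q) u g.
have sum_push (u : gT -> k) (F : subg_of Q -> k) :
    \sum_q push u q * F q = \sum_(g in H) u g * F (pr g).
  rewrite (partition_big pr xpredT) //=; apply: eq_bigr => q _.
  by rewrite /push mulr_suml; apply: eq_bigr => g /andP[_ /eqP->].
move/(slice_decomp_restrict (fun a => push (x a)) (fun b => push (y b)) (fun c q => f c (lft q))).
apply: slice_decomp_ext => a b c.
transitivity (\sum_i \sum_j push (x a) i * (push (y b) j * f c (lft (i * j)%g))).
  apply: eq_bigr => i _; apply: eq_bigr => j _.
  rewrite (bigD1 (i * j)%g) //= /group_alg_tensor eqxx mulr1 mulrA big1 ?addr0 // => l.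
  by rewrite eq_sym => /negPf->; rewrite mulr0.
under eq_bigr => i _ do rewrite -mulr_sumr sum_push.
rewrite sum_push; apply: eq_bigr => g gH; rewrite mulr_sumr; apply: eq_bigr => h hH.
by rewrite -prM // lftK ?groupM // mulrA.
Qed.

End QuotientGroupAlgebra.

(** * Symmetric powers in the defining characteristic *)

(** Independence makes the matrix of values row free, and a right inverse of it is the dual
    family. *)
Lemma dual_family (k : fieldType) (L G : finType) (P : pred G) (f : L -> G -> k) :
  (forall c : L -> k, (forall g, P g -> \sum_l c l * f l g = 0) -> forall l, c l = 0) ->
  exists x : L -> G -> k, forall l l', \sum_(g | P g) x l g * f l' g = (l == l')%:R.
Proof.
move=> indep.
pose A : 'M[k]_(#|L|, #|G|) :=
  \matrix_(i, j) if P (enum_val j) then f (enum_val i) (enum_val j) else 0.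
have /row_freeP[B AB] : row_free A.
  apply: inj_row_free => v vA0; apply/rowP=> i; rewrite mxE -(enum_valK i).
  apply: (indep (fun l => v 0 (enum_rank l))) => g Pg.
  have /rowP/(_ (enum_rank g)) := vA0; rewrite !mxE; apply: etrans.
  rewrite [RHS](reindex _ (onW_bij _ (@enum_rank_bij L))) /=.
  by apply: eq_bigr => l _; rewrite mxE !enum_rankK Pg.
exists (fun l g => B (enum_rank g) (enum_rank l)) => l l'.
have /matrixP/(_ (enum_rank l') (enum_rank l)) := AB.
rewrite !mxE (inj_eq enum_rank_inj) eq_sym => <-.
rewrite big_mkcond (reindex _ (onW_bij _ (@enum_rank_bij G))) /=.
apply: eq_bigr => g _; rewrite mxE !enum_rankK.
by case: ifP => _; rewrite ?mul0r // mulrC.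
Qed.

(** This is the image of the monomial [u^i v^l] under the substitution given by the rows of [A],
    dehomogenised at [v = 1]. *)
Definition binary_form (k : fieldType) (A : 'M[k]_2) (i l : nat) : {poly k} :=
  (A 0 0 *: 'X + (A 0 1)%:P) ^+ i * (A 1 0 *: 'X + (A 1 1)%:P) ^+ l.

(* Matrix coefficients of the r-th symmetric power, in dehomogenised monomials. *)
Definition sym_coef (k : fieldType) (r : nat) (A : 'M[k]_2) (i j : nat) : k :=
  (binary_form A i (r - i))`_j.

(** Here [q] stands for a binary form of degree [r], dehomogenised; the form is evaluated at
    [(P, Q)]. *)
Definition homog_subst (k : fieldType) (r : nat) (q P Q : {poly k}) : {poly k} :=
  \sum_(m < r.+1) q`_m *: (P ^+ m * Q ^+ (r - m)).

Lemma homog_substM (k : fieldType) (r : nat) (q P Q : {poly k}) (a b : k) :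
  (size q <= r.+1)%N ->
  homog_subst r.+1 (q * (a *: 'X + b%:P)) P Q = homog_subst r q P Q * (a *: P + b *: Q).
Proof.
move=> qr; rewrite /homog_subst [RHS]mulrDr.
transitivity (\sum_(m < r.+2) (a * (if m == 0 :> nat then 0 else q`_m.-1)) *: (P ^+ m * Q ^+ (r.+1 - m))
   + \sum_(m < r.+2) (b * q`_m) *: (P ^+ m * Q ^+ (r.+1 - m))).
  rewrite -big_split; apply: eq_bigr => m _ /=; rewrite -scalerDl; congr (_ *: _).
  by rewrite mulrDr coefD coefMC -scalerAr coefZ coefMX [b * _]mulrC.
congr (_ + _).
  rewrite big_ord_recl /= mulr0 scale0r add0r mulr_suml; apply: eq_bigr => m _ /=.
  by rewrite subSS exprS -!mul_polyC polyCM; ring.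
rewrite big_ord_recr /= (nth_default _ qr) mulr0 scale0r addr0 mulr_suml; apply: eq_bigr => m _.
by rewrite /= subSn ?leq_ord // exprS -!mul_polyC polyCM; ring.
Qed.

Lemma size_binary_form (k : fieldType) (A : 'M[k]_2) i l : (size (binary_form A i l) <= (i + l).+1)%N.
Proof.
have sz1 a b : (size (a *: 'X + b%:P : {poly k})%R <= 2)%N.
  by rewrite (leq_trans (size_polyD _ _)) // geq_max (leq_trans (size_scale_leq _ _)) ?size_polyX //
     size_polyC; case: eqP.
apply: leq_trans (size_polyMleq _ _) _.
have szX a b n : (size ((a *: 'X + b%:P : {poly k}) ^+ n)%R <= n.+1)%N.
  apply: leq_trans (size_poly_exp_leq _ _) _.
    by rewrite ltnS -[leqRHS]mul1n leq_mul2r -subn1 leq_subLR sz1 orbT.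
by rewrite -subn1 leq_subLR (leq_trans (leq_add (szX _ _ _) (szX _ _ _))) // addSn addnS.
Qed.

Lemma homog_subst_form (k : fieldType) (A : 'M[k]_2) (P Q : {poly k}) i l :
  homog_subst (i + l) (binary_form A i l) P Q =
  (A 0 0 *: P + A 0 1 *: Q) ^+ i * (A 1 0 *: P + A 1 1 *: Q) ^+ l.
Proof.
elim: i => [|i IHi].
  elim: l => [|l IHl].
    by rewrite /homog_subst big_ord1 /binary_form !expr0 mulr1 coef1 scale1r.
  rewrite add0n exprSr mulrA -IHl -homog_substM ?size_binary_form //.
  by rewrite /binary_form exprSr mulrA.
rewrite addSn exprSr mulrAC -IHi -homog_substM ?size_binary_form //.
by rewrite /binary_form exprSr mulrAC.
Qed.

Lemma sum_ord2 (V : nmodType) (F : 'I_2 -> V) : \sum_i F i = F 0 + F 1.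
Proof. by rewrite big_ord_recl big_ord1; congr (_ + F _); apply/val_inj. Qed.

(** Substituting the linear forms of [B] into the form of [A] gives the form of [A *m B]; expanding
    the form of [A] in monomials first gives the sum. *)
Lemma sym_coefM (k : fieldType) (r : nat) (A B : 'M[k]_2) i j : (i <= r)%N ->
  sym_coef r (A *m B) i j = \sum_(m < r.+1) sym_coef r A i m * sym_coef r B m j.
Proof.
move=> ir; pose PB a := B a 0 *: 'X + (B a 1)%:P : {poly k}.
transitivity (homog_subst r (binary_form A i (r - i)) (PB 0) (PB 1))`_j; last first.
  by rewrite coef_sum; apply: eq_bigr => m _; rewrite coefZ.
rewrite -[r in homog_subst r](subnKC ir) homog_subst_form /sym_coef /binary_form.
have AB a : (A *m B) a 0 *: 'X + ((A *m B) a 1)%:P = A a 0 *: PB 0 + A a 1 *: PB 1.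
  by rewrite !mxE !sum_ord2 /PB -!mul_polyC !(polyCM, polyCD); ring.
by rewrite !AB.
Qed.

(** For even [r] the central elements, with [a ^+ 2 = 1], thus act trivially and the coefficients
    live on PSL(2,p). *)
Lemma sym_coefZ (k : fieldType) (r : nat) (a : k) (A : 'M[k]_2) i j : (i <= r)%N ->
  sym_coef r (a *: A) i j = a ^+ r * sym_coef r A i j.
Proof.
move=> ir; rewrite /sym_coef /binary_form !mxE -!scalerA.
have E b c : (a * b)%:P = a *: b%:P :> {poly k} by rewrite -mul_polyC polyCM.
rewrite ![(a * _)%:P]polyCM ![a%:P * _]mul_polyC -!scalerDr !exprZn -scalerAl -scalerAr scalerA.
by rewrite -exprD subnKC // coefZ.
Qed.

Lemma Fp_rmorphism (k : fieldType) (p : nat) : p \in [pchar k] -> inhabited {rmorphism 'F_p -> k}.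
Proof.
move=> kp; have p_pr := pcharf_prime kp.
pose f (x : 'F_p) : k := (x : nat)%:R.
have fD : nmod_morphism f.
  split=> [|x y]; first by rewrite /f.
  by rewrite /f /= [X in (_ %% X)%N](Fp_cast p_pr) (GRing.natr_mod_pchar kp) natrD.
have fM : monoid_morphism f.
  split=> [|x y]; first by rewrite /f /= [X in (_ %% X)%N](Fp_cast p_pr) modn_small ?prime_gt1.
  by rewrite /f /= [X in (_ %% X)%N](Fp_cast p_pr) (GRing.natr_mod_pchar kp) natrM.
pose iota : {rmorphism 'F_p -> k} := HB.pack f (GRing.isNmodMorphism.Build 'F_p k f fD)
  (GRing.isMonoidMorphism.Build 'F_p k f fM).
exact: inhabits iota.
Qed.

Lemma poly_vanish (F : finFieldType) (k : fieldType) (iota : {rmorphism F -> k})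
    (P : {poly k}) (D : pred F) :
  (size P <= #|D|)%N -> (forall x, D x -> P.[iota x] = 0) -> P = 0.
Proof.
move=> szP P0; apply: (@roots_geq_poly_eq0 _ _ [seq iota x | x in D]).
- by apply/allP=> _ /imageP[x Dx ->]; apply/eqP/P0.
- by rewrite map_inj_uniq ?enum_uniq //; apply: fmorph_inj.
- by rewrite size_map -cardE.
Qed.

Definition mx22 (R : Type) (a b c d : R) : 'M[R]_2 :=
  \matrix_(i, j) if i == 0 then if j == 0 then a else b else if j == 0 then c else d.

Lemma det_mx2 (R : comNzRingType) (A : 'M[R]_2) : \det A = A 0 0 * A 1 1 - A 0 1 * A 1 0.
Proof.
rewrite (expand_det_row _ 0) sum_ord2 /cofactor !det_mx11 !mxE /= !expr0 !expr1.
have -> : lift 0 0 = 1 :> 'I_2 by apply/val_inj.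
have -> : lift 1 0 = 0 :> 'I_2 by apply/val_inj.
by ring.
Qed.

Lemma det_mx22 (R : comNzRingType) (a b c d : R) : \det (mx22 a b c d) = a * d - b * c.
Proof. by rewrite det_mx2 !mxE. Qed.

(* The element (1 0; b 1) diag(t, 1/t) (1 a; 0 1) of the big cell. *)
Definition big_cell (F : fieldType) (t a b : F) : 'M[F]_2 :=
  mx22 t (t * a) (b * t) (b * t * a + t^-1).

(** The second linear form is [t^-1 + b t (X + a)], the first [t (X + a)]; the binomial formula then
    displays the coefficient as a polynomial in [b]. *)
Lemma sym_coef_big_cell (F k : fieldType) (iota : {rmorphism F -> k}) (r i j : nat) (t a b : F) :
  t != 0 ->
  sym_coef r (map_mx iota (big_cell t a b)) i j =
  \sum_(m < (r - i).+1) (iota t ^+ (i + m) * (iota t)^-1 ^+ (r - i - m)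
     * (('X + (iota a)%:P) ^+ (i + m))`_j *+ 'C(r - i, m)) * iota b ^+ m.
Proof.
move=> t0; rewrite /sym_coef /binary_form !mxE /=.
have -> : iota t *: 'X + (iota (t * a))%:P = (iota t)%:P * ('X + (iota a)%:P).
  by rewrite mulrDr mul_polyC -polyCM -rmorphM.
have -> : iota (b * t) *: 'X + (iota (b * t * a + t^-1))%:P =
    (iota t)^-1%:P + (iota b)%:P * ((iota t)%:P * ('X + (iota a)%:P)).
  by rewrite -mul_polyC !rmorphD !rmorphM fmorphV /=; ring.
rewrite exprDn mulr_sumr coef_sum; apply: eq_bigr => m _.
rewrite mulrnAr coefMn mulrnAl; congr (_ *+ _).
set Z := 'X + _; set u := iota t; set v := u^-1; set w := iota b.
have -> : (u%:P * Z) ^+ i * (v%:P ^+ (r - i - m) * (w%:P * (u%:P * Z)) ^+ m) =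
    (u ^+ (i + m) * v ^+ (r - i - m) * w ^+ m)%:P * Z ^+ (i + m).
  by rewrite !exprMn !polyCM !polyC_exp !exprD; ring.
by rewrite coefCM; ring.
Qed.

Lemma bin_pchar_neq0 (k : fieldType) (p r j : nat) :
  p \in [pchar k] -> (r < p)%N -> (j <= r)%N -> 'C(r, j)%:R != 0 :> k.
Proof.
move=> kp rp jr; have p_pr := pcharf_prime kp.
have fact_ndvd n : (n < p)%N -> ~~ (p %| n`!)%N.
  elim: n => [|n IHn] np; first by rewrite dvdn1 neq_ltn prime_gt1 ?orbT.
  by rewrite factS Euclid_dvdM // negb_or gtnNdvd // IHn // ltnW.
rewrite -(dvdn_pcharf kp); apply: contra (fact_ndvd r rp) => pC.
by rewrite -(bin_fact jr) dvdn_mulr.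
Qed.

Lemma coef_XaddC_exp (k : comNzRingType) (n j : nat) (a : k) : (j <= n)%N ->
  (('X + a%:P) ^+ n)`_j = 'C(n, j)%:R * a ^+ (n - j).
Proof.
rewrite -ltnS => jn; rewrite addrC exprDn coef_sum (bigD1 (Ordinal jn)) //=.
rewrite coefMn -polyC_exp coefCM coefXn eqxx mulr1 mulr_natl big1 ?addr0 // => i ij.
rewrite coefMn -polyC_exp coefCM coefXn; move: ij; rewrite -val_eqE /= eq_sym.
by move/negPf->; rewrite mulr0 mul0rn.
Qed.

(** * Independence of the matrix coefficients of the symmetric powers *)

Section SymCoefIndependence.

Variables (k : fieldType) (p M : nat) (kp : p \in [pchar k]) (iota : {rmorphism 'F_p -> k}).
Variables (r : 'I_M -> nat) (r_inj : injective r) (r_lt : forall x, (r x < p.-1)%N).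

(** A triple is (representation, row, column). Since the degrees are below [p], one type ['I_p]
    serves for all of them, and this predicate cuts out the genuine entries. *)
Definition sym_index (l : 'I_M * 'I_p * 'I_p) := (l.1.2 <= r l.1.1)%N && (l.2 <= r l.1.1)%N.

(** On the big cell a relation is examined in [b], then [t], then [a], each time as a polynomial
    with fewer coefficients than there are values of the variable. The top power of [b] isolates one
    value of [r - i]; there the power of [t] is [t^r], which separates the representations; the
    power [a^(r - j)] then separates the columns. Descending induction on [r - i] removes the
    remaining terms. *)
Lemma sym_coef_indep (c : 'I_M * 'I_p * 'I_p -> k) :
  (forall g : 'M['F_p]_2, \det g = 1 ->
     \sum_(l | sym_index l) c l * sym_coef (r l.1.1) (map_mx iota g) l.1.2 l.2 = 0) ->
  forall l, sym_index l -> c l = 0.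
Proof.
move=> c0; have p_pr := pcharf_prime kp.
have r_ltp x : (r x < p)%N by have := r_lt x; have := prime_gt0 p_pr; lia.
pose N (l : 'I_M * 'I_p * 'I_p) := (r l.1.1 - l.1.2)%N.
suff desc d l : sym_index l -> (p - d <= N l)%N -> c l = 0.
  by move=> l lv; apply: (desc p) => //; rewrite subnn.
elim: d l => [|d IHd] l0 l0v; first by rewrite /N; have := r_ltp l0.1.1; lia.
rewrite leq_eqVlt => /orP[/eqP Nl0|lt_N]; last by apply: IHd => //; lia.
have {}IHd l : sym_index l -> (N l0 < N l)%N -> c l = 0 by move=> lv lN; apply: IHd => //; lia.
(* The coefficient of [b^m] in [sym_coef_big_cell]. *)
pose K t a (l : 'I_M * 'I_p * 'I_p) m := iota t ^+ (l.1.2 + m) * (iota t)^-1 ^+ (N l - m)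
     * (('X + (iota a)%:P) ^+ (l.1.2 + m))`_l.2 *+ 'C(N l, m).
have size_sumX (P : pred ('I_M * 'I_p * 'I_p)) (F : _ -> k) (E : _ -> nat) s :
    (forall l, P l -> E l < s)%N -> (size (\sum_(l | P l) F l *: 'X^(E l))%R <= s)%N.
  move=> Es; apply: (leq_trans (size_sum _ _ _)); apply/bigmax_leqP => l Pl.
  by rewrite (leq_trans (size_scale_leq _ _)) // size_polyXn Es.
have top_b t a : t != 0 -> \sum_(l | sym_index l && (N l == N l0)) c l * K t a l (N l0) = 0.
  move=> t0; pose P := \sum_(l | sym_index l) \sum_(m < (N l).+1) (c l * K t a l m) *: 'X^m.
  have P0 : P = 0.
    apply: (@poly_vanish _ _ iota P predT).
      rewrite card_Fp //; apply: (leq_trans (size_sum _ _ _)); apply/bigmax_leqP => l _.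
      apply: (leq_trans (size_sum _ _ _)); apply/bigmax_leqP => m _.
      rewrite (leq_trans (size_scale_leq _ _)) // size_polyXn.
      by rewrite (leq_ltn_trans (leq_ord m)) // (leq_ltn_trans (leq_subr _ _)).
    move=> b _; rewrite -(c0 (big_cell t a b)); last first.
      by rewrite det_mx22; field.
    rewrite horner_sum; apply: eq_bigr => l _; rewrite sym_coef_big_cell // horner_sum mulr_sumr.
    by apply: eq_bigr => m _; rewrite hornerZ hornerXn mulrA.
  transitivity P`_(N l0); last by rewrite P0 coef0.
  rewrite coef_sum [RHS](bigID (fun l => N l == N l0)) /= [X in _ = _ + X]big1 ?addr0; last first.
    move=> l /andP[lv nN]; rewrite coef_sum big1 // => m _; rewrite coefZ coefXn.
    case: eqP => [e|]; last by rewrite mulr0.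
    by rewrite IHd ?mul0r // ltn_neqAle eq_sym nN e leq_ord.
  apply: eq_bigr => l /andP[lv /eqP Nl]; rewrite coef_sum Nl big_ord_recr /= coefZ coefXn eqxx mulr1.
  by rewrite big1 ?add0r // => m _; rewrite coefZ coefXn gtn_eqF ?mulr0.
have top_t a : \sum_(l | (sym_index l && (N l == N l0)) && (r l.1.1 == r l0.1.1))
    c l * ('C(r l.1.1, l.2)%:R * iota a ^+ (r l.1.1 - l.2)) = 0.
  pose P := \sum_(l | sym_index l && (N l == N l0))
    (c l * ('C(r l.1.1, l.2)%:R * iota a ^+ (r l.1.1 - l.2))) *: 'X^(r l.1.1).
  have P0 : P = 0.
    (* Only nonzero [t] are available, [p - 1] of them; this is where the degrees must stay below
       [p.-1]. *)
    apply: (@poly_vanish _ _ iota P (predC1 0)).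
      by rewrite cardC1 card_Fp //; apply: size_sumX => l _.
    move=> t t0; rewrite -[RHS](top_b t a t0) horner_sum; apply: eq_bigr => l.
    case/andP=> /andP[l1r l2r] /eqP Nl; rewrite hornerZ hornerXn -mulrA; congr (_ * _).
    rewrite /K -Nl subnn expr0 mulr1 binn mulr1n subnKC // mulrC; congr (_ * _).
    by rewrite coef_XaddC_exp.
  transitivity P`_(r l0.1.1); last by rewrite P0 coef0.
  rewrite coef_sum [RHS](bigID (fun l => r l.1.1 == r l0.1.1)) /= [X in _ = _ + X]big1 ?addr0.
    by apply: eq_bigr => l /andP[_ /eqP rl]; rewrite coefZ coefXn rl eqxx mulr1.
  by move=> l /andP[_ /negPf rl]; rewrite coefZ coefXn eq_sym rl mulr0.
pose P := \sum_(l | (sym_index l && (N l == N l0)) && (r l.1.1 == r l0.1.1))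
  (c l * 'C(r l.1.1, l.2)%:R) *: 'X^(r l.1.1 - l.2).
have P0 : P = 0.
  apply: (@poly_vanish _ _ iota P predT).
    by rewrite card_Fp //; apply: size_sumX => l _; rewrite (leq_ltn_trans (leq_subr _ _)).
  move=> a _; rewrite -[RHS](top_t a) horner_sum; apply: eq_bigr => l _.
  by rewrite hornerZ hornerXn mulrA.
have := congr1 (fun q : {poly k} => q`_(r l0.1.1 - l0.2)) P0; rewrite coef0 coef_sum.
case/andP: (l0v) => l01 l02.
rewrite (bigD1 l0) /= ?l0v ?eqxx // coefZ coefXn eqxx mulr1 big1 ?addr0 => [/eqP|l]; last first.
  case/andP=> /andP[/andP[/andP[l1 l2] /eqP Nl] /eqP rl] nl; rewrite coefZ coefXn.
  case: eqP => [e|]; last by rewrite mulr0.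
  case/negP: nl; move: l l0 l01 l02 l1 l2 Nl rl e {IHd l0v Nl0 top_b top_t P P0}.
  move=> [[x i] j] [[x0 i0] j0]; rewrite /N /= => i0r j0r ir jr + rx; rewrite (r_inj rx) in ir jr *.
  move=> Nl e; apply/eqP; congr (_, _, _); apply/val_inj => /=; lia.
by rewrite mulf_eq0 (negPf (bin_pchar_neq0 kp (r_ltp _) l02)) orbF => /eqP.
Qed.

End SymCoefIndependence.

Lemma dual_family_in (k : fieldType) (L G : finType) (PL : pred L) (P : pred G) (f : L -> G -> k) :
  (forall c : L -> k, (forall g, P g -> \sum_(l | PL l) c l * f l g = 0) ->
     forall l, PL l -> c l = 0) ->
  exists x : L -> G -> k,
    forall l l', PL l -> PL l' -> \sum_(g | P g) x l g * f l' g = (l == l')%:R.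
Proof.
move=> indep.
have [|x xf] := @dual_family k {l | PL l} G P (fun l => f (val l)).
  move=> c c0 [l Pl]; pose c' l1 := if insub l1 is Some l2 then c l2 else 0.
  have -> : c (Sub l Pl) = c' l by rewrite /c' insubT.
  apply: indep => // g Pg; rewrite -[RHS](c0 g Pg).
  rewrite [LHS](reindex_omap (val : {l | PL l} -> L) insub) /=.
    by apply: eq_big => [l1|l1 _]; rewrite ?valK ?eqxx ?(valP l1) // /c' valK.
  by move=> l1 Pl1; rewrite insubT.
exists (fun l g => if insub l is Some l1 then x l1 g else 0) => l l' Pl Pl'.
by rewrite -(xf (Sub l Pl) (Sub l' Pl')) insubT.
Qed.

(** * Elements and centre of SL(2,p) *)

Definition SL2_elt (p : nat) (A : 'M['F_p]_2) : {'GL_2['F_p]} :=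
  insubd (1%g : {'GL_2['F_p]}) A.

Lemma SL2_eltE (p : nat) (A : 'M['F_p]_2) : \det A = 1 -> GLval (SL2_elt A) = A.
Proof. by move=> dA; rewrite /SL2_elt insubdK // -topredE /= unitmxE dA unitr1. Qed.

Lemma SL2_elt_in (p : nat) (A : 'M['F_p]_2) : \det A = 1 -> SL2_elt A \in SL2 p.
Proof. by move=> dA; rewrite inE SL2_eltE ?dA. Qed.

Lemma ord2P (i : 'I_2) : i = 0 \/ i = 1.
Proof. by case: i => [[|[|//]] ?]; [left|right]; apply/val_inj. Qed.

(** Commuting with the upper and lower elementary unipotents already forces a scalar matrix. *)
Lemma center_SL2 (p : nat) (z : {'GL_2['F_p]}) : z \in 'Z(SL2 p)%g ->
  exists2 a : 'F_p, a ^+ 2 = 1 & GLval z = a%:M.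
Proof.
case/centerP; rewrite inE => /eqP detz zC.
have comm (A : 'M['F_p]_2) : \det A = 1 -> GLval z *m A = A *m GLval z.
  move=> dA; have zA : (z * SL2_elt A = SL2_elt A * z)%g := zC _ (SL2_elt_in dA).
  by have := congr1 (fun g : {'GL_2['F_p]} => GLval g) zA; rewrite !GL_MxE SL2_eltE.
have zU := comm (mx22 1 1 0 1); have zL := comm (mx22 1 0 1 1).
rewrite !det_mx22 ?(mul0r, mulr0, mulr1, subr0) in zU zL.
move: (GLval z) {zU}(zU erefl) {zL}(zL erefl) detz => Z /matrixP zU /matrixP zL detz.
have := zU 0 0; rewrite !mxE !sum_ord2 !mxE /= => e1.
have := zL 0 0; rewrite !mxE !sum_ord2 !mxE /= => e2.
have := zU 0 1; rewrite !mxE !sum_ord2 !mxE /= => e3.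
have Z10 : Z 1 0 = 0.
  transitivity (1 * Z 0 0 + 1 * Z 1 0 - (Z 0 0 * 1 + Z 0 1 * 0)); first by ring.
  by rewrite e1 subrr.
have Z01 : Z 0 1 = 0.
  transitivity (Z 0 0 * 1 + Z 0 1 * 1 - (1 * Z 0 0 + 0 * Z 1 0)); first by ring.
  by rewrite e2 subrr.
have Z11 : Z 1 1 = Z 0 0.
  transitivity (1 * Z 0 1 + 1 * Z 1 1 - Z 0 1); first by ring.
  by rewrite -e3; ring.
exists (Z 0 0).
  by rewrite -detz det_mx2 Z01 Z11; ring.
apply/matrixP=> i j; rewrite mxE.
by case: (ord2P i) => ->; case: (ord2P j) => ->; rewrite ?Z01 ?Z10 ?Z11.
Qed.

(** Lagrange interpolation at the points [0, ..., M - 1], distinct in [k] as [M <= p]: [mu c]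
    extracts the coefficient of degree [c] from the values. *)
Lemma truncated_eval_dual (k : fieldType) (p M : nat) : p \in [pchar k] -> (M <= p)%N ->
  exists mu : 'I_M -> 'I_M -> k, forall c e : 'I_M,
    \sum_x mu c x * (x%:R : k) ^+ e = (c == e)%:R.
Proof.
move=> kp Mp; apply: (@dual_family k 'I_M 'I_M predT (fun e x => x%:R ^+ e)) => c c0 l.
have nat_inj (x y : 'I_M) : (x <= y)%N -> x%:R = y%:R :> k -> x = y.
  move=> xy /eqP; rewrite eq_sym -subr_eq0 -natrB // -(dvdn_pcharf kp) => pxy; apply/val_inj => /=.
  apply/eqP; rewrite eqn_leq xy /= -subn_eq0; case: posnP => // /dvdn_leq/(_ pxy).
  by have := ltn_ord y; lia.
pose P := \sum_e c e *: 'X^(nat_of_ord e).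
have P0 : P = 0.
  apply: (@roots_geq_poly_eq0 _ _ [seq (x : 'I_M)%:R | x : 'I_M]).
  - apply/allP=> _ /imageP[x _ ->]; rewrite /root horner_sum -[X in _ == X](c0 x) //.
    by apply/eqP/eq_bigr => e _; rewrite hornerZ hornerXn.
  - rewrite map_inj_uniq ?enum_uniq // => x y xy.
    by have [/nat_inj->|/ltnW/nat_inj->] := leqP x y.
  - rewrite size_map -cardE card_ord (leq_trans (size_sum _ _ _)) //; apply/bigmax_leqP => e _.
    by rewrite (leq_trans (size_scale_leq _ _)) // size_polyXn.
have := congr1 (fun q : {poly k} => q`_l) P0; rewrite coef0 coef_sum (bigD1 l) //=.
rewrite coefZ coefXn eqxx mulr1 big1 ?addr0 // => e el.
by rewrite coefZ coefXn -[_ == _]/(l == e) eq_sym (negPf el) mulr0.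
Qed.

Lemma slice_decomp_PSL2_pchar (k : closedFieldType) (p n r : nat) :
  p \in [pchar k] -> (32 * n <= p)%N ->
  slice_decomp (group_alg_tensor k (PSL2_type p)) r ->
  slice_decomp (@matpoly_tensor k n.*2 n.*2) r.
Proof.
move=> kp np; have [iota] := Fp_rmorphism kp; have p_pr := pcharf_prime kp.
(* Even degrees, so that the centre acts trivially; at least [n.*2], so that a matrix of size [n.*2]
   fits in a corner; below [10 * n], hence below [p.-1]. The [4 * n] interpolation points suffice
   for a product of two polynomials of degree below [n.*2], whose terms beyond the truncation are
   then not confused with lower ones. *)
pose rk (x : 'I_(4 * n)) := (n + x).*2.
have rk_inj : injective rk by move=> x y /double_inj/addnI/val_inj.
have rk_lt x : (rk x < p.-1)%N by rewrite /rk; have := ltn_ord x; lia.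
pose A (g : {'GL_2['F_p]}) : 'M[k]_2 := map_mx iota (GLval g).
have AM g h : A (g * h)%g = A g *m A h by rewrite /A GL_MxE map_mxM.
have [|x xdual] := @dual_family_in k _ _ (sym_index (p := p) rk) (fun g => g \in SL2 p)
  (fun l g => sym_coef (rk l.1.1) (A g) l.1.2 l.2).
  move=> c c0; apply: (@sym_coef_indep k p (4 * n) kp iota rk rk_inj rk_lt c) => g dg.
  rewrite -[RHS](c0 (SL2_elt g)); last exact: SL2_elt_in.
  by apply: eq_bigr => l _; rewrite /A SL2_eltE.
have [mu muE] := @truncated_eval_dual k p (4 * n) kp ltac:(lia).
have le_n4 : (n.*2 <= 4 * n)%N by lia.
have le_np : (n.*2 <= p)%N by lia.
pose w := widen_ord le_np.
have rk_w (y : 'I_(4 * n)) (i : 'I_n.*2) : (w i <= rk y)%N.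
  by rewrite /= /rk; have := ltn_ord i; lia.
(* The group algebra element acting on the symmetric power numbered [y] as [y^(a.2)] times a matrix
   unit, that is, as a matrix monomial in [z] evaluated at [z = y]; [Fc] interpolates back. *)
pose X (a : 'I_n.*2 * 'I_n.*2 * 'I_n.*2) (g : {'GL_2['F_p]}) :=
  \sum_(y < 4 * n) (y%:R : k) ^+ a.2 * x (y, w a.1.1, w a.1.2) g.
pose Fc (c : 'I_n.*2 * 'I_n.*2 * 'I_n.*2) (g : {'GL_2['F_p]}) :=
  \sum_(y < 4 * n) mu (widen_ord le_n4 c.2) y * sym_coef (rk y) (A g) c.1.1 c.1.2.
have pairE a (y : 'I_(4 * n)) i m : (i <= rk y)%N -> (m <= rk y)%N ->
    \sum_(g in SL2 p) X a g * sym_coef (rk y) (A g) i m =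
    (y%:R) ^+ a.2 * ((i == a.1.1) && (m == a.1.2))%:R.
  move=> ir mr; have r_ltp : (rk y < p)%N by have := rk_lt y; lia.
  under eq_bigr do rewrite mulr_suml; rewrite exchange_big /=.
  have im_v : sym_index (p := p) rk
      (y, Ordinal (leq_ltn_trans ir r_ltp), Ordinal (leq_ltn_trans mr r_ltp)).
    by rewrite /sym_index /= ir mr.
  rewrite (bigD1 y) //= [X in _ + X]big1 ?addr0 => [|y' yy'].
    under eq_bigr do rewrite -mulrA; rewrite -mulr_sumr; congr (_ * _).
    rewrite (xdual (y, w a.1.1, w a.1.2) _ _ im_v) ?/sym_index ?rk_w //=.
    by rewrite !xpair_eqE eqxx -!val_eqE /= eq_sym [_ == m]eq_sym.
  under eq_bigr do rewrite -mulrA; rewrite -mulr_sumr.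
  rewrite (xdual (y', w a.1.1, w a.1.2) _ _ im_v) ?/sym_index ?rk_w //=.
  by rewrite !xpair_eqE (negPf yy') mulr0.
clearbody X; have FcZ c z g : z \in 'Z(SL2 p)%g -> g \in SL2 p -> Fc c (z * g)%g = Fc c g.
  move=> /center_SL2[a a2 zE] _; apply: eq_bigr => y _; congr (_ * _).
  rewrite AM /A zE map_scalar_mx mul_scalar_mx sym_coefZ; last by rewrite (rk_w y c.1.1).
  by rewrite /rk -mul2n exprM -rmorphXn a2 rmorph1 expr1n mul1r.
move/(slice_decomp_quotient X X FcZ); apply: slice_decomp_ext => a b c.
transitivity (\sum_(y < 4 * n) mu (widen_ord le_n4 c.2) y * \sum_(m < (rk y).+1)
    (\sum_(g in SL2 p) X a g * sym_coef (rk y) (A g) c.1.1 m) *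
    (\sum_(h in SL2 p) X b h * sym_coef (rk y) (A h) m c.1.2)).
  transitivity (\sum_(g in SL2 p) \sum_(h in SL2 p) \sum_(y < 4 * n) \sum_(m < (rk y).+1)
      mu (widen_ord le_n4 c.2) y * (X a g * sym_coef (rk y) (A g) c.1.1 m *
        (X b h * sym_coef (rk y) (A h) m c.1.2))).
    apply: eq_bigr => g _; apply: eq_bigr => h _; rewrite mulr_sumr; apply: eq_bigr => y _.
    rewrite AM sym_coefM ?(rk_w y c.1.1) // !mulr_sumr; apply: eq_bigr => m _.
    by rewrite mulrCA; congr (_ * _); rewrite mulrACA.
  under eq_bigr => g _ do rewrite exchange_big /=.
  rewrite exchange_big; apply: eq_bigr => y _ /=.
  under eq_bigr => g _ do rewrite exchange_big /=.
  rewrite exchange_big mulr_sumr; apply: eq_bigr => m _ /=.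
  rewrite big_distrlr mulr_sumr; apply: eq_bigr => g _ /=.
  by rewrite mulr_sumr.
transitivity (\sum_(y < 4 * n) mu (widen_ord le_n4 c.2) y * (y%:R ^+ (a.2 + b.2) *
   [&& a.1.1 == c.1.1, a.1.2 == b.1.1 & b.1.2 == c.1.2]%:R)).
  apply: eq_bigr => y _; congr (_ * _).
  rewrite (bigD1 (Ordinal (rk_w y a.1.2 : (_ < (rk y).+1)%N))) //= [X in _ + X]big1 ?addr0.
    rewrite !pairE ?(rk_w y c.1.1) ?(rk_w y c.1.2) ?(rk_w y a.1.2) //.
    rewrite mulrACA -exprD -natrM mulnb eqxx andbT -!val_eqE /=.
    by rewrite [nat_of_ord a.1.1 == _]eq_sym [nat_of_ord b.1.2 == _]eq_sym.
  move=> m; rewrite -val_eqE /= => /negPf ma.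
  by rewrite pairE ?(rk_w y c.1.1) ?leq_ord // ma andbF mulr0 mul0r.
have lt_ab : (a.2 + b.2 < 4 * n)%N by have := ltn_ord a.2; have := ltn_ord b.2; lia.
under eq_bigr do rewrite mulrA.
rewrite -mulr_suml (muE _ (Ordinal lt_ab)) -natrM mulnb /matpoly_tensor -val_eqE /=.
by rewrite andbC -!andbA [nat_of_ord c.2 == _]eq_sym.
Qed.

(** * The Gelfand-Graev idempotent in the other characteristics *)

(** Take powers of a root [zeta] of [1 + X + ... + X^(p-1)]: its equation is the vanishing of the
    character sum. *)
Lemma additive_character (k : closedFieldType) (p : nat) : prime p -> p%:R != 0 :> k ->
  exists psi : 'F_p -> k, [/\ forall x y, psi (x + y) = psi x * psi y, psi 0 = 1
    & \sum_x psi x = 0].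
Proof.
move=> p_pr pk; pose P : {poly k} := \poly_(i < p) 1.
have szP : size P = p by rewrite size_poly_eq ?oner_eq0.
have [|zeta] := closed_rootP P _; first by rewrite szP neq_ltn prime_gt1 ?orbT.
move=> /eqP; rewrite horner_poly => Pz.
have zp : zeta ^+ p = 1.
  apply/eqP; rewrite -subr_eq0 subrX1; under eq_bigr do rewrite -[_ ^+ _]mul1r.
  by rewrite Pz mulr0.
exists (fun x : 'F_p => zeta ^+ x); split => //.
  by move=> x y; rewrite -exprD /= [X in (_ %% X)%N](Fp_cast p_pr) (expr_mod _ zp).
rewrite -[RHS]Pz -(big_mkord xpredT (fun i => zeta ^+ i)) (Fp_cast p_pr) big_mkord.
by apply: eq_bigr => i _; rewrite mul1r.
Qed.

(* Locked: otherwise failed unifications of matrix products try to compute with #|'rV[F]_2|. *)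
HB.lock Definition plane_mx (F : finFieldType) (k : fieldType) (A : 'M[F]_2) : 'M[k]_#|'rV[F]_2| :=
  \matrix_(i, j) (enum_val i *m A == enum_val j)%:R.
Arguments plane_mx {F} k A.

(** * The permutation module of the plane *)

Section PlaneRepresentation.

Variables (F : finFieldType) (k : fieldType).

Let N := #|'rV[F]_2|.

Definition point_vec (v : 'rV[F]_2) : 'rV[k]_N := delta_mx 0 (enum_rank v).

Local Notation plane_mx := (@plane_mx F k).

Lemma point_vec_mul v A : point_vec v *m plane_mx A = point_vec (v *m A).
Proof.
apply/rowP=> j; rewrite plane_mx.unlock /point_vec -rowE !mxE eqxx /= enum_rankK.
by rewrite -(inj_eq enum_rank_inj) enum_valK eq_sym.
Qed.

Lemma plane_mxP (n : nat) (B C : 'M[k]_(N, n)) :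
  (forall v, point_vec v *m B = point_vec v *m C) -> B = C.
Proof.
move=> BC; apply/row_matrixP=> i; rewrite !rowE.
by have := BC (enum_val i); rewrite /point_vec enum_valK.
Qed.

Lemma plane_mxM A B : plane_mx (A *m B) = plane_mx A *m plane_mx B.
Proof. by apply: plane_mxP => v; rewrite mulmxA !point_vec_mul mulmxA. Qed.

Lemma plane_mx1 : plane_mx 1%:M = 1%:M.
Proof. by apply: plane_mxP => v; rewrite point_vec_mul !mulmx1. Qed.

Definition pt (x y : F) : 'rV[F]_2 := \row_j if j == 0 then x else y.

Lemma pt_mul x y a b c d : pt x y *m mx22 a b c d = pt (x * a + y * c) (x * b + y * d).
Proof. by apply/rowP=> j; rewrite !mxE sum_ord2 !mxE /=; case: (ord2P j) => ->. Qed.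

Lemma mx22M (a b c d a' b' c' d' : F) : mx22 a b c d *m mx22 a' b' c' d' =
  mx22 (a * a' + b * c') (a * b' + b * d') (c * a' + d * c') (c * b' + d * d').
Proof.
apply/matrixP=> i j; rewrite !mxE sum_ord2 !mxE /=.
by case: (ord2P i) => ->; case: (ord2P j) => ->.
Qed.

Lemma pt_inj x y x' y' : (pt x y == pt x' y') = (x == x') && (y == y').
Proof.
apply/eqP/andP=> [/rowP e|[/eqP-> /eqP->] //].
by have := e 0; have := e 1; rewrite !mxE /= => -> ->.
Qed.

End PlaneRepresentation.

(** * The idempotent of an additive character and its Hecke operators *)

Section Gelfand_Graev.

Variables (F : finFieldType) (k : fieldType) (psi : F -> k) (q : k).
Hypothesis psiD : forall x y, psi (x + y) = psi x * psi y.
Hypothesis psi0 : psi 0 = 1.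
Hypothesis sum_psi : \sum_x psi x = 0.
Hypothesis q_card : q = #|F|%:R.
Hypothesis q_neq0 : q != 0.

Local Notation rho := (@plane_mx F k).
Local Notation vec x y := (point_vec k (pt x y)).

Definition unip (b : F) := mx22 1 b 0 1.
Definition torus (z : F) := mx22 z 0 0 z^-1.
Definition weyl (s : F) := mx22 0 s (- s^-1) 0.

Lemma sum_psi_scale c : \sum_x psi (c * x) = if c == 0 then q else 0.
Proof.
case: eqP => [->|/eqP c0].
  by under eq_bigr do rewrite mul0r psi0; rewrite sumr_const q_card.
rewrite -[RHS]sum_psi [RHS](reindex (fun x => c * x)) //.
by exists (fun x => c^-1 * x) => x _; rewrite ?mulKf ?mulVKf.
Qed.

Definition whittaker_idem := q^-1 *: \sum_b psi (- b) *: rho (unip b).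
Local Notation e := whittaker_idem.

Lemma unip_idem c : rho (unip c) *m e = psi c *: e.
Proof.
rewrite /e -scalemxAr scalerA [psi c * _]mulrC -scalerA; congr (_ *: _).
rewrite mulmx_sumr scaler_sumr [RHS](reindex_inj (addrI c)) /=.
apply: eq_bigr => b _; rewrite -scalemxAr -plane_mxM mx22M scalerA -psiD opprD addNKr.
by rewrite !(mul1r, mul0r, mulr0, mulr1, add0r, addr0) [b + c]addrC.
Qed.

Lemma idemK : e *m e = e.
Proof.
rewrite {1}/e -scalemxAl mulmx_suml.
under eq_bigr do rewrite -scalemxAl unip_idem scalerA -psiD addNr psi0 scale1r.
by rewrite sumr_const -scaler_nat scalerA -q_card mulVf // scale1r.
Qed.

(** Conjugation by the torus element turns [psi] into the character [b -> psi (z ^- 2 * b)],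
    different from [psi]; distinct characters have orthogonal idempotents. *)
Lemma idem_torus z : z != 0 -> z ^+ 2 != 1 -> e *m rho (torus z) *m e = 0.
Proof.
move=> z0 z2; rewrite {1}/e -!scalemxAl !mulmx_suml.
have -> : \sum_b psi (- b) *: rho (unip b) *m rho (torus z) *m e =
    (\sum_b psi ((z ^- 2 - 1) * b)) *: (rho (torus z) *m e).
  rewrite scaler_suml; apply: eq_bigr => b _.
  have -> : (z ^- 2 - 1) * b = - b + z ^- 2 * b by ring.
  rewrite psiD -!scalemxAl -scalerA; congr (_ *: _).
  have -> : rho (unip b) *m rho (torus z) = rho (torus z) *m rho (unip (z ^- 2 * b)).
    rewrite -!plane_mxM; congr plane_mx; rewrite !mx22M.
    by congr mx22; field.
  by rewrite -mulmxA unip_idem scalemxAr.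
rewrite sum_psi_scale subr_eq0 invr_eq1 (negPf z2).
by rewrite scale0r scaler0.
Qed.

Definition whittaker_vec (c : F) := vec c 0 *m e.
Local Notation v := whittaker_vec.

(** The point [(c, d)] is the translate of [(c, 0)] by [unip (d / c)]. With [vec0_idem] this shows
    that the image of [e] is spanned by the [v c] with [c] nonzero, a copy of the group ring of the
    torus. *)
Lemma vec_idem c d : c != 0 -> vec c d *m e = psi (d / c) *: v c.
Proof.
move=> c0; rewrite /v scalemxAr -unip_idem mulmxA point_vec_mul pt_mul.
by rewrite !(mulr1, mul0r, addr0) mulrC divfK.
Qed.

Lemma vec0_idem d : vec 0 d *m e = 0.
Proof.
rewrite /e -scalemxAr mulmx_sumr.
under eq_bigr do rewrite -scalemxAr point_vec_mul pt_mul !(mulr1, mul0r, add0r, mulr0, addr0).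
have -> : \sum_b psi (- b) *: vec 0 d = (\sum_b psi (- 1 * b)) *: vec 0 d.
  by rewrite scaler_suml; apply: eq_bigr => b _; rewrite mulN1r.
by rewrite sum_psi_scale oppr_eq0 oner_eq0 scale0r scaler0.
Qed.

Lemma vE c : v c = q^-1 *: \sum_b psi (- b) *: vec c (c * b).
Proof.
rewrite /v /e -scalemxAr mulmx_sumr; congr (_ *: _); apply: eq_bigr => b _.
by rewrite -scalemxAr point_vec_mul pt_mul !(mulr1, mul0r, addr0).
Qed.

Lemma v_idem c : v c *m e = v c.
Proof. by rewrite /v -mulmxA idemK. Qed.

(** In [vE] the Weyl element moves [(y, y b)] to [(- y b / s, y s)]. With [b = - s z] this is
    [(z y, y s)], which [e] sends to [psi (s / z) *: v (z * y)], while [psi (- b) = psi (s z)]. The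
    term [b = 0] is killed by [vec0_idem]. *)
Lemma v_weyl y s : y != 0 -> s != 0 ->
  v y *m rho (weyl s) *m e = q^-1 *: \sum_(z | z != 0) psi (s * (z + z^-1)) *: v (z * y).
Proof.
move=> y0 s0; rewrite vE -!scalemxAl !mulmx_suml; congr (_ *: _).
rewrite (bigD1 0) //= mulr0 -!scalemxAl point_vec_mul pt_mul !(mul0r, mulr0, add0r, addr0).
rewrite vec0_idem scaler0 add0r.
rewrite (reindex_onto (fun z => - (s * z)) (fun b => - (s^-1 * b))) /=; last first.
  by move=> b _; field.
apply: eq_big => [z|z z0].
  rewrite oppr_eq0 mulf_eq0 (negPf s0) /= andb_idr // => _.
  by apply/eqP; field.
have z0' : z != 0 by move: z0; rewrite oppr_eq0 mulf_eq0 (negPf s0) => /andP[].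
rewrite -!scalemxAl point_vec_mul pt_mul !(mulr0, addr0, add0r).
have -> : y * - (s * z) * - s^-1 = z * y by field.
rewrite vec_idem ?mulf_neq0 // scalerA -psiD opprK; congr (psi _ *: _).
by field; rewrite y0 z0'.
Qed.

(** A Fourier transform in [s] of the Kloosterman-type kernel of [v_weyl], designed to select the
    [z] with [z + 1/z = tau]. The missing term [s = 0] causes the constant [- q^-1] in [v_hecke]. *)
Definition hecke_op (tau : F) := \sum_(s | s != 0) psi (- (s * tau)) *: (e *m rho (weyl s) *m e).

Lemma hecke_idemr tau : hecke_op tau *m e = hecke_op tau.
Proof.
rewrite /hecke_op mulmx_suml; apply: eq_bigr => s _.
by rewrite -scalemxAl -!mulmxA idemK.
Qed.

Lemma v_hecke y tau : y != 0 -> v y *m hecke_op tau =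
  \sum_(z | z != 0) ((z + z^-1 == tau)%:R - q^-1) *: v (z * y).
Proof.
move=> y0; rewrite /hecke_op mulmx_sumr.
transitivity (\sum_(s | s != 0) \sum_(z | z != 0)
    (q^-1 * psi ((z + z^-1 - tau) * s)) *: v (z * y)).
  apply: eq_bigr => s s0; rewrite -scalemxAr !mulmxA v_idem v_weyl // !scaler_sumr.
  apply: eq_bigr => z _; rewrite !scalerA [_ * q^-1]mulrC -mulrA -psiD; congr ((_ * psi _) *: _); ring.
rewrite exchange_big; apply: eq_bigr => z _ /=; rewrite -scaler_suml -mulr_sumr; congr (_ *: _).
set c := z + z^-1 - tau.
have -> : \sum_(s | s != 0) psi (c * s) = (if c == 0 then q else 0) - 1.
  by rewrite -sum_psi_scale [in RHS](bigD1 0) //= mulr0 psi0 addrAC subrr add0r.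
rewrite mulrBr mulr1 subr_eq0.
by case: eqP => _; rewrite ?mulr0 ?mulVf.
Qed.

Definition vcomb (g : F -> k) := \sum_(z | z != 0) g z *: v z.

(** Among the [v z], only [v c] involves the point [(c, 0)]; so [g] can be read off the vector. *)
Lemma vcomb_coord g c : c != 0 -> vcomb g 0 (enum_rank (pt c 0)) = q^-1 * g c.
Proof.
move=> c0; rewrite summxE (bigD1 c) //= big1 ?addr0 => [|z /andP[z0 zc]]; rewrite vE !mxE summxE.
  rewrite (bigD1 0) //= big1 ?addr0 => [|b b0].
    by rewrite mulr0 oppr0 psi0 !mxE !eqxx mulr1 mulr1 mulrC.
  rewrite !mxE eqxx /= (inj_eq enum_rank_inj) pt_inj eqxx /=.
  by rewrite eq_sym mulf_eq0 (negPf c0) (negPf b0) mulr0.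
rewrite big1 ?mulr0 ?mulr0 // => b _.
by rewrite !mxE eqxx /= (inj_eq enum_rank_inj) pt_inj eq_sym (negPf zc) mulr0.
Qed.

(** The equation [z + 1/z = z0 + 1/z0] has exactly the solutions [z0] and [1/z0], distinct because
    [z0 ^+ 2 != 1]. The subtracted term, independent of [z], is the multiple of the norm element. *)
Lemma vcomb_hecke g z0 : z0 != 0 -> z0 ^+ 2 != 1 ->
  vcomb g *m hecke_op (z0 + z0^-1) =
  vcomb (fun z => g (z0^-1 * z) + g (z0 * z) - q^-1 * \sum_(y | y != 0) g y).
Proof.
move=> z00 z02; rewrite /vcomb mulmx_suml.
transitivity (\sum_(y | y != 0) \sum_(x | x != 0)
    (g y * ((x / y + y / x == z0 + z0^-1)%:R - q^-1)) *: v x).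
  apply: eq_bigr => y y0; rewrite -scalemxAl v_hecke // scaler_sumr.
  rewrite [RHS](reindex_onto (fun z => z * y) (fun x => x / y)) /=; last first.
    by move=> x _; rewrite divfK.
  apply: eq_big => [z|z zn0].
    by rewrite mulf_eq0 (negPf y0) orbF mulfK // eqxx andbT.
  by rewrite scalerA mulfK // invfM mulrCA divff // mulr1.
rewrite exchange_big; apply: eq_bigr => x x0 /=; rewrite -scaler_suml; congr (_ *: _).
under [LHS]eq_bigr do rewrite mulrBr.
rewrite sumrB -mulr_suml [q^-1 * _]mulrC; congr (_ - _).
have xz1 : z0^-1 * x != 0 by rewrite mulf_neq0 ?invr_eq0.
have xz2 : z0 * x != 0 by rewrite mulf_neq0.
have neq12 : z0 * x != z0^-1 * x.
  by rewrite (inj_eq (mulIf x0)) -(inj_eq (mulfI z00)) divff // -expr2.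
rewrite (bigD1 (z0^-1 * x)) //= (bigD1 (z0 * x)) /=; last by rewrite xz2 neq12.
rewrite [X in _ + (_ + X)]big1 ?addr0 => [|y /andP[/andP[y0 y1] y2]].
  have -> : x / (z0^-1 * x) + z0^-1 * x / x == z0 + z0^-1 by apply/eqP; field; rewrite z00.
  have -> : x / (z0 * x) + z0 * x / x == z0 + z0^-1 by apply/eqP; field; rewrite z00.
  by rewrite !mulr1.
case: eqP => [E|]; last by rewrite mulr0.
suff : (y - z0^-1 * x) * (y - z0 * x) == 0.
  by rewrite mulf_eq0 !subr_eq0 (negPf y1) (negPf y2).
have -> : (y - z0^-1 * x) * (y - z0 * x) = x * y * (x / y + y / x - (z0 + z0^-1)).
  by field; rewrite z00 x0.
by rewrite E subrr mulr0.
Qed.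

End Gelfand_Graev.

(** * The image of the group algebra of SL(2,p) in the plane representation *)

Section SL2Span.

Variables (k : fieldType) (p : nat).
Local Notation rho := (@plane_mx 'F_p k).

Definition in_SL2_span (X : 'M[k]_#|'rV['F_p]_2|) :=
  exists x : {'GL_2['F_p]} -> k, X = \sum_(g in SL2 p) x g *: rho (GLval g).

Lemma span_rho A : \det A = 1 -> in_SL2_span (rho A).
Proof.
move=> dA; exists (fun g => (g == SL2_elt A)%:R).
rewrite (bigD1 (SL2_elt A)) ?SL2_elt_in //= eqxx scale1r SL2_eltE // big1 ?addr0 //.
by move=> g /andP[_ /negPf->]; rewrite scale0r.
Qed.

Lemma spanZ a X : in_SL2_span X -> in_SL2_span (a *: X).
Proof.
move=> [x ->]; exists (fun g => a * x g); rewrite scaler_sumr.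
by apply: eq_bigr => g _; rewrite scalerA.
Qed.

Lemma span_sum (I : finType) (P : pred I) (X : I -> 'M[k]_#|'rV['F_p]_2|) :
  (forall i, P i -> in_SL2_span (X i)) -> in_SL2_span (\sum_(i | P i) X i).
Proof.
move=> XP; apply: big_ind => [|Y Z [y ->] [z ->]|//].
  by exists (fun _ => 0); rewrite big1 // => g _; rewrite scale0r.
exists (fun g => y g + z g); rewrite -big_split /=.
by apply: eq_bigr => g _; rewrite scalerDl.
Qed.

Lemma spanM X Y : in_SL2_span X -> in_SL2_span Y -> in_SL2_span (X *m Y).
Proof.
move=> [x ->] [y ->]; rewrite mulmx_suml; apply: span_sum => g gS.
rewrite mulmx_sumr; apply: span_sum => h hS.
rewrite -scalemxAl -scalemxAr; do 2![apply: spanZ].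
move: gS hS; rewrite !inE -plane_mxM => /eqP dg /eqP dh.
by apply: span_rho; rewrite det_mulmx dg dh mulr1.
Qed.

Lemma span_mulmx_entry (L : 'rV[k]_#|'rV['F_p]_2|) (R : 'cV[k]_#|'rV['F_p]_2|)
    (x y : {'GL_2['F_p]} -> k) :
  (L *m ((\sum_(g in SL2 p) x g *: rho (GLval g)) *m (\sum_(h in SL2 p) y h *: rho (GLval h))) *m R) 0 0
  = \sum_(g in SL2 p) \sum_(h in SL2 p) x g * y h * (L *m rho (GLval (g * h)%g) *m R) 0 0.
Proof.
rewrite mulmx_suml mulmx_sumr mulmx_suml summxE; apply: eq_bigr => g _.
rewrite !mulmx_sumr mulmx_suml summxE; apply: eq_bigr => h _.
by rewrite -scalemxAl -[rho _ *m (_ *: _)]scalemxAr scalerA -scalemxAr -scalemxAl mxE GL_MxE plane_mxM.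
Qed.

Lemma center_absorb (L : 'rV[k]_#|'rV['F_p]_2|) (B : 'M['F_p]_2) (z g : {'GL_2['F_p]}) :
  z \in 'Z(SL2 p)%g -> L *m rho (GLval z) = L ->
  L *m rho B *m rho (GLval (z * g)%g) = L *m rho B *m rho (GLval g).
Proof.
move=> /center_SL2[a _ za] Lz; rewrite GL_MxE plane_mxM mulmxA; congr (_ *m _).
by rewrite -[in RHS]Lz za -!mulmxA -!plane_mxM scalar_mxC.
Qed.

End SL2Span.

Lemma SL2_unip (F : finFieldType) (b : F) : \det (unip b) = 1.
Proof. by rewrite det_mx22; ring. Qed.

Lemma SL2_torus (F : finFieldType) (z : F) : z != 0 -> \det (torus z) = 1.
Proof. by move=> z0; rewrite det_mx22; field. Qed.

Lemma SL2_weyl (F : finFieldType) (s : F) : s != 0 -> \det (weyl s) = 1.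
Proof. by move=> s0; rewrite det_mx22; field. Qed.

(** A generator of the multiplicative group, of order [p.-1]. *)
Lemma Fp_large_order (p : nat) : prime p -> exists2 z : 'F_p, z != 0 &
  forall i : nat, (0 < i.*2 < p.-1)%N -> z ^+ i.*2 != 1.
Proof.
move=> p_pr; have p1 := prime_gt1 p_pr.
have : has p.-1.-primitive_root (enum (predC1 (0 : 'F_p))).
  apply: has_prim_root; first by lia.
  - apply/allP=> x; rewrite mem_enum inE => x0; apply/unity_rootP.
    apply: (mulfI x0); rewrite -exprS prednK ?prime_gt0 // mulr1.
    by have := expf_card x; rewrite card_Fp.
  - exact: enum_uniq.
  - by rewrite -cardE cardC1 card_Fp.
case/hasP=> z; rewrite mem_enum inE => z0 prim_z; exists z => // i /andP[i0 ip].
by rewrite -(prim_order_dvd prim_z) gtnNdvd.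
Qed.

(** * Powers of the Hecke operator and matrix units from the torus *)

Section CrossCharacteristic.

Variables (k : closedFieldType) (p : nat) (p_pr : prime p) (psi : 'F_p -> k).
Hypothesis psiD : forall x y, psi (x + y) = psi x * psi y.
Hypothesis psi0 : psi 0 = 1.
Hypothesis sum_psi : \sum_x psi x = 0.
Let q : k := #|'F_p|%:R.
Hypothesis q_neq0 : q != 0.
Variables (zeta : 'F_p) (m : nat).
Hypothesis neq1N1 : 1 != -1 :> 'F_p.
Hypothesis zeta0 : zeta != 0.
Hypothesis zeta_order : forall i : nat, (0 < i < m)%N -> zeta ^+ i.*2 != 1.

Local Notation rho := (@plane_mx 'F_p k).
Local Notation e := (whittaker_idem psi q).
Local Notation Y := (hecke_op psi q (zeta + zeta^-1)).

Definition hecke_pow a := iter a (fun X => X *m Y) e.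

Lemma hecke_powS a : hecke_pow a.+1 = hecke_pow a *m Y. Proof. by []. Qed.

Lemma hecke_pow_idemr a : hecke_pow a *m e = hecke_pow a.
Proof.
case: a => [|a]; first exact: idemK.
by rewrite hecke_powS -mulmxA hecke_idemr.
Qed.

Lemma hecke_pow_ideml a : e *m hecke_pow a = hecke_pow a.
Proof.
elim: a => [|a IHa]; first exact: idemK.
by rewrite hecke_powS mulmxA IHa.
Qed.

Lemma hecke_powD a b : hecke_pow a *m hecke_pow b = hecke_pow (a + b).
Proof.
elim: b => [|b IHb]; first by rewrite addn0 hecke_pow_idemr.
by rewrite addnS !hecke_powS mulmxA IHb.
Qed.

Lemma span_hecke_pow a : in_SL2_span (hecke_pow a).
Proof.
have span_e : in_SL2_span e.
  by apply: spanZ; apply: span_sum => b _; apply: spanZ; apply/span_rho/SL2_unip.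
elim: a => [|a IHa] //; rewrite hecke_powS; apply: spanM => //.
apply: span_sum => s s0; apply: spanZ; apply: spanM => //; apply: spanM => //.
exact/span_rho/SL2_weyl.
Qed.

(** The central element -1 exchanges the two summands, so functionals built from this vector descend
    to PSL(2,p). *)
Definition even_vec := whittaker_vec psi q 1 + whittaker_vec psi q (-1).

Lemma even_vec_idem : even_vec *m e = even_vec.
Proof. by rewrite mulmxDl !v_idem. Qed.

(* Modulo the sum of all whittaker_vec, multiplication by Y is x + 1/x on the group ring of the torus,
   and x^a occurs in (x + 1/x)^a but not in lower powers. *)
Lemma even_vec_hecke_pow a : (a.*2 < m)%N -> exists g kappa,
  [/\ even_vec *m hecke_pow a = vcomb psi q g, g (zeta ^+ a) = kappa + 1
    & forall i, (a < i)%N -> (i + a < m)%N -> g (zeta ^+ i) = kappa].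
Proof.
elim: a => [|a IHa] am.
  exists (fun z => (z == 1)%:R + (z == -1)%:R), 0; split.
  - rewrite even_vec_idem /vcomb; under eq_bigr do rewrite scalerDl.
    rewrite big_split /=; congr (_ + _).
      rewrite (bigD1 1) ?oner_eq0 // eqxx scale1r /= big1 ?addr0 // => z /andP[_ /negPf->].
      by rewrite scale0r.
    rewrite (bigD1 (-1)) ?oppr_eq0 ?oner_eq0 // eqxx scale1r /= big1 ?addr0 // => z /andP[_ /negPf->].
    by rewrite scale0r.
  - by rewrite expr0 eqxx (negPf neq1N1) addr0 add0r.
  - move=> i i0; rewrite addn0 => im; have := zeta_order (i := i); rewrite i0 im => /(_ isT).
    rewrite -muln2 exprM sqrf_eq1 negb_or => /andP[/negPf-> /negPf->].
    by rewrite addr0.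
have [g [kappa [gE ga gi]]] := IHa ltac:(lia).
have zeta2 : zeta ^+ 2 != 1 by apply: (@zeta_order 1); lia.
(* At [zeta ^+ a.+1] the first term gives the new leading value [kappa + 1], the second [kappa]. The
   second term looks one exponent ahead, which is why the range [i + a < m] shrinks as [a] grows. *)
exists (fun z => g (zeta^-1 * z) + g (zeta * z) - q^-1 * \sum_(y | y != 0) g y).
exists (kappa + kappa - q^-1 * \sum_(y | y != 0) g y); split.
- by rewrite hecke_powS mulmxA gE vcomb_hecke.
- by rewrite [in X in g X + _]exprS mulKf // ga -exprS gi; [ring|lia|lia].
- by case=> // i ai im; rewrite [in X in g X + _]exprS mulKf // -exprS !gi //; lia.
Qed.

Lemma hecke_dual (H : nat) : (H.*2 <= m)%N ->
  exists phi : 'I_H -> 'cV[k]_#|'rV['F_p]_2|,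
  forall a c : 'I_H, (even_vec *m hecke_pow a *m phi c) 0 0 = (a == c)%:R.
Proof.
move=> Hm; have zetaX0 i : zeta ^+ i != 0 by rewrite expf_neq0.
(* Subtracting the value at [zeta ^+ H] cancels the unknown [kappa], since [H] exceeds every
   exponent [a]. The matrix [T] then is lower triangular with ones on the diagonal, and its inverse
   yields the dual family. *)
pose chi i : 'cV[k]_#|'rV['F_p]_2| :=
  q *: (delta_mx (enum_rank (pt (zeta ^+ i) 0)) 0 - delta_mx (enum_rank (pt (zeta ^+ H) 0)) 0).
pose T : 'M[k]_H := \matrix_(a, i) (even_vec *m hecke_pow a *m chi i) 0 0.
have chiE g i : (vcomb psi q g *m chi i) 0 0 = g (zeta ^+ i) - g (zeta ^+ H).
  rewrite /chi -scalemxAr mulmxBr -!colE !mxE !vcomb_coord // -mulrBr mulVKf //.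
have T_trig : is_trig_mx T.
  apply/is_trig_mxP=> a i ai; rewrite mxE.
  have [|g [kappa [-> _ gi]]] := @even_vec_hecke_pow a; first by have := ltn_ord a; lia.
  by rewrite chiE !gi ?subrr //; have := ltn_ord i; lia.
have T_unit : T \in unitmx.
  rewrite unitmxE det_trig // big1 ?unitr1 // => a _; rewrite mxE.
  have [|g [kappa [-> ga gi]]] := @even_vec_hecke_pow a; first by have := ltn_ord a; lia.
  by rewrite chiE ga gi ?[kappa + 1]addrC ?addrK //; have := ltn_ord a; lia.
exists (fun c => \sum_i invmx T i c *: chi i) => a c.
have /matrixP/(_ a c) TV := mulmxV T_unit; rewrite !mxE in TV; rewrite -TV.
rewrite mulmx_sumr summxE; apply: eq_bigr => i _.
by rewrite -scalemxAr !mxE mulrC.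
Qed.

Lemma even_vec_center z : z \in 'Z(SL2 p)%g -> even_vec *m rho (GLval z) = even_vec.
Proof.
case/center_SL2=> a /eqP; rewrite sqrf_eq1 => a1 ->.
case/orP: a1 => /eqP->; first by rewrite plane_mx1 mulmx1.
have eC : e *m rho (-1)%:M = rho (-1)%:M *m e.
  rewrite /e -scalemxAl -scalemxAr mulmx_suml mulmx_sumr; congr (_ *: _).
  apply: eq_bigr => b _; rewrite -scalemxAl -scalemxAr -[in LHS]plane_mxM -[in RHS]plane_mxM.
  by rewrite scalar_mxC.
have vN c : whittaker_vec psi q c *m rho (-1)%:M = whittaker_vec psi q (- c).
  rewrite /whittaker_vec -mulmxA eC mulmxA point_vec_mul; congr (point_vec k _ *m _).
  by rewrite mul_mx_scalar; apply/rowP=> j; rewrite !mxE mulN1r; case: eqP => _; rewrite ?oppr0.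
by rewrite /even_vec mulmxDl !vN opprK addrC.
Qed.

Lemma zeta_sqr_neq (i j : nat) : (i < m)%N -> (j < m)%N -> i != j -> (zeta ^+ j / zeta ^+ i) ^+ 2 != 1.
Proof.
have neq i' j' : (i' < j')%N -> (j' < m)%N -> zeta ^+ j'.*2 != zeta ^+ i'.*2.
  move=> ij jm; rewrite -(subnKC ij) addSnnS doubleD exprD -[X in _ != X]mulr1.
  by rewrite (inj_eq (mulfI _)) ?expf_neq0 // zeta_order //; lia.
move=> im jm ij; rewrite expr_div_n -!exprM !muln2.
rewrite -(inj_eq (mulIf (expf_neq0 i.*2 zeta0))) divfK ?expf_neq0 // mul1r.
by move: ij; rewrite neq_ltn => /orP[|] lt; [|rewrite eq_sym]; apply: neq.
Qed.

(** For [i != j] the two torus elements combine into one with square different from 1, and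
    [idem_torus] applies between the copies of [e] supplied by [A] and [B]. This is the
    multiplication rule of matrix units. *)
Lemma idem_torus_ortho (A B : 'M[k]_#|'rV['F_p]_2|) (i j : nat) : (i < m)%N -> (j < m)%N ->
  A *m e = A -> e *m B = B ->
  A *m rho (torus (zeta ^+ i)^-1) *m rho (torus (zeta ^+ j)) *m B = (i == j)%:R *: (A *m B).
Proof.
move=> im jm Ae eB; rewrite -(mulmxA A) -plane_mxM.
have -> : torus (zeta ^+ i)^-1 *m torus (zeta ^+ j) = torus (zeta ^+ j / zeta ^+ i).
  by rewrite mx22M; congr mx22; field; rewrite !expf_neq0.
case: eqP => [->|/eqP ij].
  rewrite divff ?expf_neq0 // scale1r.
  have -> : torus 1 = 1%:M :> 'M['F_p]_2.
    by apply/matrixP=> x y; rewrite !mxE invr1; case: (ord2P x) => ->; case: (ord2P y) => ->.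
  by rewrite plane_mx1 mulmx1.
have z0 : zeta ^+ j / zeta ^+ i != 0 by rewrite mulf_neq0 ?invr_eq0 ?expf_neq0.
have eTe := idem_torus psiD psi0 sum_psi (erefl q) z0 (zeta_sqr_neq im jm ij).
by rewrite -Ae -eB scale0r mulmxA -(mulmxA A) -(mulmxA A) eTe mulmx0 mul0mx.
Qed.

Lemma hecke_pow_torus (i j a b : nat) : (i < m)%N -> (j < m)%N ->
  hecke_pow a *m rho (torus (zeta ^+ i)^-1) *m rho (torus (zeta ^+ j)) *m hecke_pow b =
  (i == j)%:R *: hecke_pow (a + b).
Proof.
move=> im jm; rewrite -[in RHS](hecke_powD a b).
exact: idem_torus_ortho im jm (hecke_pow_idemr a) (hecke_pow_ideml b).
Qed.

End CrossCharacteristic.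

(** * The lower bound *)

Lemma slice_decomp_PSL2_cross (k : closedFieldType) (p n r : nat) :
  prime p -> p%:R != 0 :> k -> (0 < n)%N -> (32 * n <= p)%N ->
  slice_decomp (group_alg_tensor k (PSL2_type p)) r ->
  slice_decomp (@matpoly_tensor k n.*2 n.*2) r.
Proof.
move=> p_pr pk n0 np; have [psi [psiD psi0 sum_psi]] := additive_character p_pr pk.
have [zeta zeta0 zeta_ord] := Fp_large_order p_pr.
pose m := p.-1./2.
have zeta_order i : (0 < i < m)%N -> zeta ^+ i.*2 != 1.
  by move=> im; apply: zeta_ord; move: im; rewrite /m; lia.
have q0 : #|'F_p|%:R != 0 :> k by rewrite card_Fp.
have neq1N1 : 1 != -1 :> 'F_p.
  rewrite -subr_eq0 opprK -(natrD _ 1 1) -(dvdn_pcharf (pchar_Fp p_pr)) gtnNdvd //.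
  by lia.
(* Exponents up to [4 * n] accommodate the sum of two degrees below [n.*2]; [32 * n <= p] ensures
   [8 * n <= m]. *)
have [phi phiE] := @hecke_dual k p p_pr psi psiD psi0 sum_psi q0 zeta m neq1N1 zeta0 zeta_order
  (4 * n) ltac:(rewrite /m; lia).
have le_n4 : (n.*2 <= 4 * n)%N by lia.
have ltm (i : 'I_n.*2) : (i < m)%N by have := ltn_ord i; rewrite /m; lia.
pose q : k := #|'F_p|%:R.
pose hp := hecke_pow psi zeta; pose ev := even_vec psi.
pose T i := plane_mx k (torus (zeta ^+ i)); pose T' i := plane_mx k (torus (zeta ^+ i)^-1).
(* These play the role of matrix units times [z^(a.2)]; [f] below reads off the entry
   [(c.1.1, c.1.2)] and, by [phi], the coefficient of degree [c.2]. *)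
pose X (a : 'I_n.*2 * 'I_n.*2 * 'I_n.*2) := T a.1.1 *m hp a.2 *m T' a.1.2.
have X_span a : in_SL2_span (X a).
  apply: spanM; first apply: spanM.
  - by apply/span_rho/SL2_torus; rewrite expf_neq0.
  - exact: span_hecke_pow.
  - by apply/span_rho/SL2_torus; rewrite invr_eq0 expf_neq0.
have [x xE] := fin_all_exists X_span.
pose Rc (c : 'I_n.*2 * 'I_n.*2 * 'I_n.*2) := T c.1.2 *m hp 0 *m phi (widen_ord le_n4 c.2).
pose f (c : 'I_n.*2 * 'I_n.*2 * 'I_n.*2) (g : {'GL_2['F_p]}) :=
  (ev *m T' c.1.1 *m plane_mx k (GLval g) *m Rc c) 0 0.
have fZ c z g : z \in 'Z(SL2 p)%g -> g \in SL2 p -> f c (z * g)%g = f c g.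
  move=> zZ _; congr ((_ *m _) 0 0).
  exact: center_absorb zZ (even_vec_center psi zZ).
move/(slice_decomp_quotient x x fZ); apply: slice_decomp_ext => a b c.
transitivity ((ev *m T' c.1.1 *m (X a *m X b) *m Rc c) 0 0).
  by rewrite xE [X b]xE span_mulmx_entry.
(* Inserting the idempotent [hp 0] after [ev] gives the leftmost pair of torus elements the shape
   required by [ortho], which then collapses all three pairs. *)
have ev0 : ev *m hp 0 = ev := even_vec_idem psiD psi0 q0.
have ortho (i j : 'I_n.*2) a' b' : hp a' *m T' i *m T j *m hp b' = (i == j :> nat)%:R *: hp (a' + b')%N.
  exact: (hecke_pow_torus p_pr psiD psi0 sum_psi q0 neq1N1 zeta0 zeta_order a' b' (ltm i) (ltm j)).
have {}phiE (a' c' : 'I_(4 * n)) : (ev *m hp a' *m phi c') 0 0 = (a' == c')%:R := phiE a' c'.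
rewrite /X /Rc; clearbody hp ev T T'; rewrite !mulmxA -{1}ev0.
have -> : ev *m hp 0 *m T' c.1.1 *m T a.1.1 *m hp a.2 *m T' a.1.2 *m T b.1.1 *m hp b.2 *m T' b.1.2
      *m T c.1.2 *m hp 0 =
    ev *m (hp 0 *m T' c.1.1 *m T a.1.1 *m hp a.2 *m T' a.1.2 *m T b.1.1 *m hp b.2
      *m T' b.1.2 *m T c.1.2 *m hp 0) by rewrite !mulmxA.
rewrite ortho -!scalemxAl ortho -!scalemxAl ortho.
rewrite -!scalemxAr -!scalemxAl !scalerA mxE add0n addn0.
have lt_ab : (a.2 + b.2 < 4 * n)%N by have := ltn_ord a.2; have := ltn_ord b.2; lia.
rewrite (phiE (Ordinal lt_ab)) -!natrM !mulnb /matpoly_tensor.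
by rewrite -!andbA [nat_of_ord c.1.1 == _]eq_sym.
Qed.

Lemma slice_decomp0 (k : fieldType) (I1 I2 I3 : finType) (T : I1 -> I2 -> I3 -> k) a b c :
  slice_decomp T 0 -> T a b c = 0.
Proof.
case=> r1 [r2] [r3] [] /eqP; rewrite !addn_eq0 => /andP[/andP[/eqP-> /eqP->] /eqP->].
by case=> f1 [g1] [f2] [g2] [f3] [g3] ->; rewrite !big_ord0 !addr0.
Qed.

Lemma slice_rankP (k : fieldType) (I1 I2 I3 : finType) (T : I1 -> I2 -> I3 -> k) :
  slice_decomp T (slice_rank T).
Proof.
by rewrite /slice_rank; case: ex_minnP => r + _; rewrite /slice_decompb;
   case: ClassicalDescription.excluded_middle_informative.
Qed.

Lemma slice_rank_PSL2 : exists2 d : nat, (0 < d)%N & forall (p : nat) (k : closedFieldType),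
  prime p -> (p ^ 3 <= d ^ 3 * slice_rank (group_alg_tensor k (PSL2_type p)))%N.
Proof.
(* The integer part of [p / 32] is at least [p / 64] once [p >= 32]. Smaller [p] only need a nonzero
   slice rank, which holds as the tensor is nonzero. *)
have [d d32 le_d] : exists2 d : nat, (32 <= d)%N &
    forall p, (32 <= p)%N -> (p <= d * (p %/ 32))%N.
  by exists 64 => // p; lia.
exists d => [|p k p_pr]; first exact: leq_trans d32.
set r := slice_rank _.
have rP : slice_decomp (group_alg_tensor k (PSL2_type p)) r := slice_rankP _.
have [p_small|p_large] := ltnP p 32.
  have r0 : (0 < r)%N.
    rewrite lt0n; apply/eqP => r0; move: rP; rewrite r0.
    move/(slice_decomp0 1%g 1%g 1%g)/eqP; rewrite /group_alg_tensor mulg1 eqxx.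
    by rewrite oner_eq0.
  by rewrite (leq_trans _ (leq_pmulr _ r0)) // leq_exp2r // ltnW // (leq_trans p_small).
have n0 : (0 < p %/ 32)%N by rewrite divn_gt0.
have np : (32 * (p %/ 32) <= p)%N by rewrite mulnC leq_trunc_div.
have nr : ((p %/ 32) ^ 3 <= r)%N.
  rewrite expnS; apply: (@slice_rank_matpoly k).
  have [pk|pk] := eqVneq (p%:R : k) 0; last exact: (slice_decomp_PSL2_cross p_pr).
  by apply: (slice_decomp_PSL2_pchar _ np rP); rewrite inE p_pr pk eqxx.
apply: (@leq_trans ((d * (p %/ 32)) ^ 3)); first by rewrite leq_exp2r // le_d.
by rewrite expnMn leq_mul2l nr orbT.
Qed.

Theorem theorem1p4 :
  exists c : rat, 0 < c /\
    forall p : nat, prime p ->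
    forall k : closedFieldType,
      c * (p ^ 3)%:R <= (slice_rank (group_alg_tensor k (PSL2_type p)))%:R.
Proof.
have [d d0 le_d] := slice_rank_PSL2.
have d3 : 0 < (d ^ 3)%:R :> rat by rewrite ltr0n expn_gt0 d0.
exists (d ^ 3)%:R^-1; split; first by rewrite invr_gt0.
by move=> p p_pr k; rewrite ler_pdivrMl // -natrM ler_nat le_d.
Qed.
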